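(* Let $I\subseteq\mathbb{R}$ be an interval and $E:=\mathbb{R}_+\times I$, where $\mathbb{R}_+=[0,\infty)$. Let $(P_t)_{t\ge 0}$ be a strongly continuous, positive, contraction semigroup of linear operators on $C_0(E)$ that is a space-time semigroup, i.e. for all $t\ge 0$ and $(s,x)\in E$ the subprobability measure $P_t((s,x),\cdot)$ on $E$ is concentrated on $\{s+t\}\times I$. Suppose that the associated strong Markov process $W$ on $E^\partial=E\cup\{\partial\}$, with life-time $\zeta$, is a diffusion process, i.e. its sample paths are continuous on $[0,\zeta)$. For $t\ge 0$ let $Q_t$ be the subprobability kernel on $I$ defined by $Q_t(x,B):=P_t((0,x),\mathbb{R}_+\times B)=P_t((0,x),\{t\}\times B)$, and for a finite signed measure $\mu$ on $I$ put $(\mu Q_t)(B):=\int_I\mu(dx)\,Q_t(x,B)$. Then $$\Sigma(\mu Q_s)\ \ge\ \Sigma(\mu Q_t)$$ for all finite signed measures $\mu$ on $I$ and all $0\le s<t<\infty$, where $\Sigma(\cdot)\in\{-1,0,1,2,\ldots\}\cup\{\infty\}$ denotes the number of zero-crossings of a signed measure.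
   Context: **Number of zero-crossings.** Let $\mu$ be a Radon signed measure on $I$ with Hahn–Jordan decomposition $\mu=\mu^+-\mu^-$. For $n\in\mathbb{N}=\{1,2,\ldots\}$ define non-negative Radon measures $\mu_n^+,\mu_n^-$ on $I^n$ by alternating products: $\mu_1^+:=\mu^+$, $\mu_2^+:=\mu^+\otimes\mu^-$, $\mu_3^+:=\mu^+\otimes\mu^-\otimes\mu^+,\ldots$ and $\mu_1^-:=\mu^-$, $\mu_2^-:=\mu^-\otimes\mu^+$, $\mu_3^-:=\mu^-\otimes\mu^+\otimes\mu^-,\ldots$. Let $H_n:=\{(x_1,\ldots,x_n)\in I^n: x_1<x_2<\cdots<x_n\}$. The number of zero-crossings of $\mu$ is $$\Sigma(\mu):=\sup\{n:\mu_n^+(H_n)>0\text{ or }\mu_n^-(H_n)>0\}-1,$$ with the convention that the supremum of the empty set is $0$ (so $\Sigma(0)=-1$). **Semigroup and process.** $C_0(E)$ is the space of continuous real functions on $E$ vanishing at infinity. $P_t(w,\cdot)$, $w\in E$, also denotes the subprobability measure on $E$ with $(P_tf)(w)=\int_E P_t(w,dw')f(w')$ for $f\in C_0(E)$. $E^\partial$ is the one-point compactification of $E$, with point at infinity $\partial$. Define probability kernels $P_t^\partial$ on $E^\partial$ by $P_t^\partial(w,B):=P_t(w,B\cap E)+(1-P_t(w,E))\delta_\partial(B)$ for $w\in E$ and $P_t^\partial(\partial,B):=\delta_\partial(B)$. These define a strongly continuous, positive, contraction semigroup on $C(E^\partial)$, and $(W,(\mathbb{P}^w)_{w\in E^\partial})$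 is the associated (Feller, càdlàg) strong Markov process with state space $E^\partial$ and transition semigroup $(P_t^\partial)_{t\ge0}$. Its life-time is $\zeta:=\inf\{s\ge 0:W_s=\partial\}$, and $W_t=\partial$ for all $t\ge\zeta$. *)

(* Defs.v *)
From HB Require Import structures.
From mathcomp Require Import all_boot all_order all_algebra.
From mathcomp Require Import all_classical all_reals all_analysis.
From mathcomp Require Import measurable_realfun.

Set Implicit Arguments.
Unset Strict Implicit.
Unset Printing Implicit Defensive.

Import Order.TTheory GRing.Theory Num.Theory.
Import numFieldNormedType.Exports.

Local Open Scope classical_set_scope.
Local Open Scope ring_scope.

(* A nonempty subset of the line, as a topological space in its own right. The
   nonemptiness proof is carried by the type because measurable spaces are
   pointed. *)
Definition subline (R : realType) (A : set R) (A0 : A !=set0) : Type :=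
  set_type A.

Section subline_instances.
Context (R : realType) (A : set R) (A0 : A !=set0).

Definition subline_val (x : subline A0) : R := @set_val R A x.

Let subline_point : subline A0 := exist _ (sval (cid A0)) (mem_set (svalP (cid A0))).

HB.instance Definition _ := Topological.copy (subline A0) (set_type A).
HB.instance Definition _ := isPointed.Build (subline A0) subline_point.

End subline_instances.

Lemma nonneg_neq0 (R : realType) : [set s : R | 0 <= s] !=set0.
Proof. by exists 0 => /=. Qed.

Notation half_line R := (subline (nonneg_neq0 R)).

Definition half_line0 (R : realType) : half_line R :=
  exist _ 0 (mem_set (lexx 0 : [set s : R | 0 <= s] 0)).

(* A topological space with its Borel sigma-algebra. *)
Definition borel (T : Type) : Type := T.

Section borel_instances.
Context (T : ptopologicalType).

HB.instance Definition _ := Topological.on (borel T).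
HB.instance Definition _ := Pointed.on (borel T).
HB.instance Definition _ := @isMeasurable.Build (sigma_display (@open T))
  (borel T) <<s @open T >> (@sigma_algebra0 _ setT (@open T))
  (@sigma_algebraC _ (@open T)) (@sigma_algebra_bigcup _ setT (@open T)).

End borel_instances.

Lemma continuous_borel_measurable (T U : ptopologicalType)
  (f : borel T -> borel U) :
  continuous (f : T -> U) -> measurable_fun [set: borel T] f.
Proof.
move=> cf; apply: (@measurability _ _ _ _ _ f (@open U)) => //.
move=> _ [B oB <-]; rewrite setTI; apply: sub_sigma_algebra.
by move/continuousP : cf; exact.
Qed.

Definition time_space (R : realType) (I : set R) (I0 : I !=set0) : Type :=
  (half_line R * subline I0)%type.

HB.instance Definition _ (R : realType) (I : set R) (I0 : I !=set0) :=
  Topological.on (time_space I0).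
HB.instance Definition _ (R : realType) (I : set R) (I0 : I !=set0) :=
  Pointed.on (time_space I0).

(* [spacetime I0] is the state space [0, +oo) x I; [spacetime_pt I0] is its
   one-point compactification, [None] being the point at infinity. *)
Notation spacetime I0 := (borel (time_space I0)).
Notation spacetime_pt I0 := (borel (one_point_compactification (time_space I0))).

Section charges.
Context d (T : measurableType d) (R : realType).
Implicit Type mu : {charge set T -> \bar R}.
Local Open Scope ereal_scope.

Let hahn mu := svalP (cid (svalP (cid (Hahn_decomposition mu)))).

(* The Jordan parts do not depend on the chosen Hahn decomposition. *)
Definition charge_pos mu : {finite_measure set T -> \bar R} :=
  jordan_pos (hahn mu).

Definition charge_neg mu : {finite_measure set T -> \bar R} :=
  jordan_neg (hahn mu).

Definition charge_integral mu (f : T -> \bar R) : \bar R :=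
  \int[charge_pos mu]_x f x - \int[charge_neg mu]_x f x.

End charges.

Section charge_kernel.
Context d (T : measurableType d) (R : realType).
Variables (mu : {charge set T -> \bar R}) (Q : R.-spker T ~> T).
Local Open Scope ereal_scope.

Definition charge_kernel (B : set T) : \bar R := charge_integral mu (Q ^~ B).

Let fin (m : {finite_measure set T -> \bar R}) B : measurable B ->
  \int[m]_x Q x B \is a fin_num.
Proof.
move=> mB; rewrite ge0_fin_numE; last by apply: integral_ge0 => x _.
apply: (@le_lt_trans _ _ (\int[m]_x cst 1 x)).
  apply: ge0_le_integral => //; first exact: measurable_kernel.
  move=> x _; apply: le_trans (sprob_kernel_le1 Q x).
  by apply: le_measure; rewrite ?inE.
by rewrite integral_cst// mul1e -ge0_fin_numE// fin_num_measure.
Qed.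

Let additive (m : {finite_measure set T -> \bar R}) :
  semi_sigma_additive (fun B => \int[m]_x Q x B).
Proof.
move=> F mF tF mUF.
have -> : \int[m]_x Q x (\bigcup_n F n) = \sum_(n <oo) \int[m]_x Q x (F n).
  rewrite -integral_nneseries//; last by move=> n; exact: measurable_kernel.
  by apply: eq_integral => x _; rewrite measure_semi_bigcup.
by apply: is_cvg_nneseries => n _ _; exact: integral_ge0.
Qed.

Let charge_kernel0 : charge_kernel set0 = 0.
Proof.
rewrite /charge_kernel /charge_integral.
by rewrite !integral0_eq ?subee// => x _; rewrite measure0.
Qed.

Let charge_kernel_fin B : measurable B -> charge_kernel B \is a fin_num.
Proof. by move=> mB; rewrite fin_numB !fin. Qed.

Let charge_kernel_additive : semi_sigma_additive charge_kernel.
Proof.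
move=> F mF tF mUF; rewrite /charge_kernel /charge_integral.
rewrite (_ : (fun _ => _) = (fun n => \sum_(0 <= i < n) \int[charge_pos mu]_x Q x (F i)
   - \sum_(0 <= i < n) \int[charge_neg mu]_x Q x (F i))); last first.
  apply/funext => n; rewrite -fin_num_sumeN; last by move=> i _; exact: fin.
  by rewrite -big_split.
apply: cvgeB; [|exact: additive|exact: additive].
by rewrite fin_num_adde_defr// fin.
Qed.

HB.instance Definition _ := isCharge.Build _ _ _ charge_kernel
  charge_kernel0 charge_kernel_fin charge_kernel_additive.

End charge_kernel.

Section zero_crossings.
Context (R : realType) (I : set R) (I0 : I !=set0).
Local Notation J := (borel (subline I0)).
Local Open Scope ereal_scope.

(* mu (x) nu (x) mu (x) ... with n factors, on I^n; the empty product is the unit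
   mass on the one-point space I^0. *)
Fixpoint alternating_product (mu nu : {measure set J -> \bar R}) (n : nat) :
    set (n.-tuple J) -> \bar R :=
  if n is m.+1 then
    pushforward (mu \x @alternating_product nu mu m)
      (fun p => [tuple of p.1 :: p.2])
  else \d_[tuple].

Definition increasing_tuples (n : nat) : set (n.-tuple J) :=
  [set x | forall i j : 'I_n, (i < j)%N ->
     (subline_val (tnth x i) < subline_val (tnth x j))%R].

Definition has_alternation (mu : {charge set J -> \bar R}) (n : nat) : Prop :=
  0 < alternating_product (charge_pos mu) (charge_neg mu) (@increasing_tuples n)
  \/
  0 < alternating_product (charge_neg mu) (charge_pos mu) (@increasing_tuples n).

(* Adding 0 to the set implements the convention that its supremum is 0 when it
   is empty. *)
Definition zero_crossings (mu : {charge set J -> \bar R}) : \bar R :=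
  ereal_sup (0 |` [set n%:R%:E | n in
    [set n : nat | (1 <= n)%N /\ has_alternation mu n]]) - 1.

End zero_crossings.

Section C0_semigroup.
Context (R : realType) (X : topologicalType).

Definition C0 (f : X -> R) : Prop :=
  continuous f /\
  forall e : R, 0 < e ->
    exists2 K : set X, compact K & forall x, ~ K x -> `|f x| < e.

Definition sup_norm (f : X -> R) : R := sup [set `|f x| | x in [set: X]].

(* Times are real numbers; only [T t] for [0 <= t] and its values on [C0]
   matter. *)
Record C0_contraction_semigroup (T : R -> (X -> R) -> X -> R) : Prop := {
  C0sg_C0 : forall t f, 0 <= t -> C0 f -> C0 (T t f) ;
  C0sg_linear : forall t a f g, 0 <= t -> C0 f -> C0 g ->
    T t (fun x => a * f x + g x) = (fun x => a * T t f x + T t g x) ;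
  C0sg_positive : forall t f, 0 <= t -> C0 f ->
    (forall x, 0 <= f x) -> forall x, 0 <= T t f x ;
  C0sg_contraction : forall t f, 0 <= t -> C0 f ->
    sup_norm (T t f) <= sup_norm f ;
  C0sg_0 : forall f, C0 f -> T 0 f = f ;
  C0sg_add : forall s t f, 0 <= s -> 0 <= t -> C0 f ->
    T (s + t) f = T s (T t f) ;
  C0sg_continuous : forall f, C0 f ->
    sup_norm (fun x => T t f x - f x) @[t --> 0^'+] --> (0 : R) }.

End C0_semigroup.

Section strong_Markov_process.
Context (R : realType) (S : ptopologicalType).
Context d (Omega : measurableType d).
Local Open Scope ereal_scope.

Definition natural_filtration (W : R -> Omega -> borel S) (t : R) :
    set (set Omega) :=
  <<s [set A | exists u (B : set (borel S)),
        [/\ (0 <= u <= t)%R, measurable B & A = W u @^-1` B]] >>.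

(* Stopping times of the right-continuous filtration, and the sigma-algebra of
   events known at such a time. *)
Definition optional_time (W : R -> Omega -> borel S) (tau : Omega -> \bar R) :
    Prop :=
  (forall o, 0 <= tau o) /\
  forall t : R, (0 <= t)%R -> natural_filtration W t [set o | tau o < t%:E].

Definition events_at (W : R -> Omega -> borel S) (tau : Omega -> \bar R) :
    set (set Omega) :=
  [set A | measurable A /\ forall t : R, (0 <= t)%R ->
     natural_filtration W t (A `&` [set o | tau o < t%:E])].

(* [p t w B] is the probability of a transition from [w] to [B] in time [t].
   Taking for [tau] a constant time gives the Markov property with transition
   semigroup [p]. *)
Record cadlag_strong_Markov (p : R -> borel S -> set (borel S) -> \bar R)
    (Pr : borel S -> probability Omega R) (W : R -> Omega -> borel S) : Prop := {
  csM_measurable : forall t : R, (0 <= t)%R -> measurable_fun [set: Omega] (W t) ;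
  csM_start : forall w, Pr w [set o | W 0%R o = w] = 1 ;
  csM_right_continuous : forall o (t : R), (0 <= t)%R ->
    W s o @[s --> t^'+] --> W t o ;
  csM_left_limit : forall o (t : R), (0 < t)%R ->
    exists l : borel S, W s o @[s --> t^'-] --> l ;
  csM_strong_Markov : forall w tau A (t : R) (B : set (borel S)),
    optional_time W tau -> events_at W tau A -> (0 <= t)%R -> measurable B ->
    Pr w (A `&` [set o | tau o < +oo /\ B (W (fine (tau o) + t)%R o)]) =
    \int[Pr w]_(o in A `&` [set o | tau o < +oo]) p t (W (fine (tau o)) o) B }.

End strong_Markov_process.

Section space_time.
Context (R : realType) (I : set R) (I0 : I !=set0).
Local Notation J := (borel (subline I0)).
Local Notation E := (spacetime I0).
Local Notation Ept := (spacetime_pt I0).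
Local Open Scope ereal_scope.

(* The kernels representing the operators of a semigroup on C_0(E). *)
Definition represents (T : R -> (E -> R) -> E -> R) (P : R -> R.-spker E ~> E) :
    Prop :=
  forall t f w, (0 <= t)%R -> C0 f -> (T t f w)%:E = \int[P t w]_y (f y)%:E.

Definition is_space_time (P : R -> R.-spker E ~> E) : Prop :=
  forall t (w : E), (0 <= t)%R ->
    P t w [set e | subline_val e.1 <> (subline_val w.1 + t)%R] = 0.

Definition extended_kernel (P : R -> R.-spker E ~> E) (t : R) (w : Ept)
    (B : set Ept) : \bar R :=
  if w is Some e then
    P t e [set e' | B (Some e')] + (1 - P t e [set: E]) * \d_(None : Ept) B
  else \d_(None : Ept) B.

Section process.
Context d (Omega : measurableType d).

Definition lifetime (W : R -> Omega -> Ept) (o : Omega) : \bar R :=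
  ereal_inf [set s%:E | s in [set s : R | (0 <= s)%R /\ W s o = None]].

Record associated_process (P : R -> R.-spker E ~> E)
    (Pr : Ept -> probability Omega R) (W : R -> Omega -> Ept) : Prop := {
  process_strong_Markov : cadlag_strong_Markov (extended_kernel P) Pr W ;
  process_absorbed : forall o (t : R), (0 <= t)%R -> lifetime W o <= t%:E ->
    W t o = None }.

(* Path continuity is only a property of the semigroup up to null sets, hence the
   almost sure formulation. *)
Definition is_diffusion (Pr : Ept -> probability Omega R)
    (W : R -> Omega -> Ept) : Prop :=
  forall w, {ae Pr w, forall o,
    {within [set t : R | (0 <= t)%R /\ t%:E < lifetime W o],
      continuous (fun t => W t o)}}.

End process.

Section spatial_kernel.
Variables (P : R -> R.-spker E ~> E) (t : R).

Definition spatial_kernel (x : J) (B : set J) : \bar R :=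
  P t ((half_line0 R, x) : E) [set e | B e.2].

Let at0 (x : J) : E := (half_line0 R, x).
Let space (e : E) : J := e.2.

Let measurable_at0 : measurable_fun [set: J] at0.
Proof.
apply: continuous_borel_measurable => x U [[A B]/= [nA nB] AB].
by apply: filterS nB => y By; apply: AB; split => //=; exact: nbhs_singleton.
Qed.

Let measurable_space B : measurable B -> measurable (space @^-1` B).
Proof.
have mf : measurable_fun [set: E] space.
  by apply: continuous_borel_measurable => -[s x]; exact: cvg_snd.
by move=> mB; rewrite -[X in measurable X]setTI; exact: mf.
Qed.

Let spatial_kernel0 x : spatial_kernel x set0 = 0.
Proof. exact: measure0. Qed.

Let spatial_kernel_ge0 x B : 0 <= spatial_kernel x B.
Proof. exact: measure_ge0. Qed.

Let spatial_kernel_additive x : semi_sigma_additive (spatial_kernel x).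
Proof.
move=> F mF tF mUF.
have := @measure_semi_sigma_additive _ _ _ (P t (at0 x))
  (fun n => space @^-1` F n).
rewrite -preimage_bigcup; apply.
- by move=> n; exact: measurable_space.
- apply/trivIsetP => i j _ _ ij; rewrite -preimage_setI.
  by move/trivIsetP : tF => /(_ _ _ Logic.I Logic.I ij) ->; rewrite preimage_set0.
- exact: measurable_space.
Qed.

HB.instance Definition _ x := isMeasure.Build _ _ _ (spatial_kernel x)
  (spatial_kernel0 x) (spatial_kernel_ge0 x) (@spatial_kernel_additive x).

Definition mspatial_kernel : J -> {measure set J -> \bar R} := spatial_kernel.

Let measurable_spatial_kernel B : measurable B ->
  measurable_fun [set: J] (mspatial_kernel ^~ B).
Proof.
move=> mB; have mP : measurable_fun [set: E] (P t ^~ (space @^-1` B)).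
  by apply: measurable_kernel; exact: measurable_space.
exact: (measurableT_comp mP measurable_at0).
Qed.

HB.instance Definition _ := @isKernel.Build _ _ _ _ _ mspatial_kernel
  measurable_spatial_kernel.

Let spatial_kernel_le1 :
  ereal_sup [set mspatial_kernel x [set: J] | x in [set: J]] <= 1.
Proof. by apply: ge_ereal_sup => _ [x _ <-]; exact: sprob_kernel_le1. Qed.

HB.instance Definition _ := @Kernel_isSubProbability.Build _ _ _ _ _
  mspatial_kernel spatial_kernel_le1.

End spatial_kernel.

End space_time.

(* Main.v *)
Require Import Defs.
From HB Require Import structures.
From mathcomp Require Import all_boot all_order all_algebra.
From mathcomp Require Import all_classical all_reals all_analysis.
From mathcomp Require Import measurable_realfun.
From mathcomp Require Import ring lra zify.

Set Implicit Arguments.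
Unset Strict Implicit.
Unset Printing Implicit Defensive.

Import Order.TTheory GRing.Theory Num.Theory.
Import numFieldNormedType.Exports.

Local Open Scope classical_set_scope.
Local Open Scope ring_scope.

(** Why the number of zero-crossings cannot increase.

    Functions.  Put [a = t - s] and let [F] be in C_0(E).  Under the law of the
    process started at [w], the process [r |-> T_(a-r) F (W_r)] is a martingale
    on [[0, a]].  If it starts from a value [T_a F w > 0], then with positive
    probability it stays above half of that value, for stopping it there would
    otherwise lose half of its mean; so some continuous path runs from [w] to a
    point where [F > 0] and keeps
    [T_(a-r) F] positive all the way ([surviving_path]).  If [T_a F] has
    opposite signs at two points with the same time coordinate, the two
    corresponding paths cannot meet, since at the meeting point [T_(a-r) F]
    would have both signs.  Being continuous, they keep their order.  Hence the
    sign changes of [T_a F] along the line [time = s] are all found, in the same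
    pattern, in [F] along the line [time = t]
    ([semigroup_variation_diminishing]).  One path per point suffices: no joint
    law of several particles is involved.

    Measures.  Suppose that [mu Q_t] alternates [n + 1] times and that
    [nu = mu Q_s] does not.  By regularity there are functions [f_j >= 0] in C_0
    with successive disjoint supports and [(-1)^j (mu Q_t)(f_j) > 0]
    ([alternating_test_functions]), while the interval splits into [n]
    consecutive blocks on which [nu] has a constant sign ([two_sided_blocks]).
    Extend [f_j] to [F_j] on E and let [g_j] be [T_a F_j] along [time = s]; the
    semigroup law gives [(mu Q_t)(f_j) = nu(g_j)] ([signed_integral_kernel]).
    The [n] by [n + 1] matrix of the integrals of [g_j] against [|nu|] over the
    blocks inherits the variation-diminishing property: a sign of an entry of
    its product with a vector [c] is taken by [\sum_j c_j g_j] somewhere on the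
    block.  Its row space contains the alternating vector [nu(g_j)], and linear
    algebra excludes that ([variation_diminishing_no_alternation]). *)

(** * Variation-diminishing matrices *)
Section variation_diminishing_matrices.
Variable R : realFieldType.

Definition alternates_along (I : Type) (m : nat) (x : I -> R) (h : 'I_m -> I) :=
  forall i : 'I_m, 0 < (-1) ^+ i * x (h i).

Definition increasing (m n : nat) (h : 'I_m -> 'I_n) :=
  forall i j : 'I_m, (i < j)%N -> (h i < h j)%N.

(** The pattern may be asked to start with a plus sign: replacing [c] by [- c]
    gives the patterns that start with a minus sign. *)
Definition variation_diminishing k n (N : 'M[R]_(k, n)) :=
  forall (c : 'cV_n) m (h : 'I_m -> 'I_k),
    increasing h -> alternates_along ((N *m c)^~ 0) h ->
    exists2 h' : 'I_m -> 'I_n, increasing h' & alternates_along (c^~ 0) h'.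

Lemma increasing_ge m n (h : 'I_m -> 'I_n) : increasing h ->
  forall i : 'I_m, (i <= h i)%N.
Proof.
move=> hh [i]; elim: i => //= i IH im.
have im' : (i < m)%N by apply: ltn_trans im.
exact: leq_ltn_trans (IH im') (hh (Ordinal im') (Ordinal im) _).
Qed.

(** There is room for a single gap: once an increasing map into a set with one
    more element has left the identity, it is the successor map. *)
Lemma increasing_shift m (h : 'I_m -> 'I_m.+1) (j : 'I_m) : increasing h ->
  h j != j :> nat -> forall i : 'I_m, (j <= i)%N -> h i = i.+1 :> nat.
Proof.
move=> hh hj i ji.
have le1 d (l : 'I_m) : l = (j + d)%N :> nat -> (l < h l)%N.
  elim: d l => [|d IH] l ld.
    have -> : l = j by apply/val_inj; rewrite /= ld addn0.
    by have := increasing_ge hh j; move/eqP: hj; lia.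
  have lm' : (j + d < m)%N by have := ltn_ord l; lia.
  have := hh (Ordinal lm') l; have := IH (Ordinal lm'); rewrite /=; lia.
apply/eqP; rewrite eqn_leq (le1 (i - j)%N) ?subnKC// andbT.
have le2 d (l : 'I_m) : (l + d.+1 = m)%N -> (h l <= l.+1)%N.
  elim: d l => [|d IH] l ld; first by have := ltn_ord (h l); lia.
  have lm : (l.+1 < m)%N by lia.
  have := hh l (Ordinal lm) (leqnn _).
  by have := IH (Ordinal lm); rewrite /=; lia.
by apply: (le2 (m - i.+1)%N); have := ltn_ord i; lia.
Qed.

(** A nonzero [c] in the kernel of [N] is orthogonal to [v], so [c] agrees in
    sign with the alternating pattern at one index [p] and disagrees at another
    index [q].  As [N] is onto, adding a small multiple of a suitable [e] to [c]
    makes [N *m c] alternate on all rows, starting with either sign.  A pattern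
    of [k] signs inside the [k + 1] entries of the perturbed [c] skips one entry
    only, which cannot account for both [p] and [q]. *)
Lemma row_free_no_alternation k (N : 'M[R]_(k, k.+1)) (v : 'rV_k.+1) :
  variation_diminishing N -> row_free N -> (v <= N)%MS ->
  ~ alternates_along (v 0) id.
Proof.
move=> VN fN vN altv.
have [c c0 Nc] : exists2 c : 'cV_k.+1, c != 0 & N *m c = 0.
  have : kermx N^T != 0.
    rewrite kermx_eq0 /row_free mxrank_tr; apply/eqP => rk.
    by have := rank_leq_row N; rewrite rk ltnn.
  move=> /rowV0Pn[u /sub_kermxP uN u0]; exists u^T; first by rewrite trmx_eq0.
  by rewrite -[N]trmxK -trmx_mul uN trmx0.
have /row_freeP[B NB] := fN.
pose e : 'cV_k.+1 := B *m (\col_i (-1) ^+ i).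
have Ne : N *m e = \col_i (-1) ^+ i by rewrite mulmxA NB mul1mx.
have vc : \sum_j v 0 j * c j 0 = 0.
  have : (v *m c) 0 0 = 0.
    by have /submxP[D ->] := vN; rewrite -mulmxA Nc mulmx0 mxE.
  by rewrite mxE.
pose g (j : 'I_k.+1) := (-1) ^+ j * c j 0.
have vg : \sum_j `|v 0 j| * g j = 0.
  rewrite -[RHS]vc; apply: eq_bigr => j _; rewrite /g.
  have := altv j; rewrite /= -[in X in X -> _]signr_odd -![(-1) ^+ j]signr_odd.
  case: odd; rewrite ?expr1 ?expr0; last by rewrite !mul1r => /gtr0_norm ->.
  by rewrite !mulN1r oppr_gt0 => /ltr0_norm ->; rewrite mulrNN.
have vgt0 j : 0 < `|v 0 j|.
  by rewrite normr_gt0; apply: contraTneq (altv j) => /= ->; rewrite mulr0 ltxx.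
have [j0 cj0] : exists j, c j 0 != 0.
  apply/existsP; apply: contraNT c0; rewrite negb_exists => /forallP c0.
  by apply/eqP/matrixP => i j; rewrite !ord1 mxE; have := c0 i; rewrite negbK => /eqP.
have gj0 : g j0 != 0 by rewrite mulf_neq0// signr_eq0.
have [p gp] : exists p, 0 < g p.
  apply/existsP; apply: contraT; rewrite negb_exists => /forallP gle.
  have /eqP : \sum_j (- (`|v 0 j| * g j)) = 0 by rewrite sumrN vg oppr0.
  rewrite psumr_eq0 => [/allP/(_ j0)|j _]; last first.
    by rewrite oppr_ge0 pmulr_rle0// leNgt.
  by rewrite mem_index_enum oppr_eq0 mulf_eq0 (gt_eqF (vgt0 _)) (negPf gj0) => /(_ isT).
have [q gq] : exists q, g q < 0.
  apply/existsP; apply: contraT; rewrite negb_exists => /forallP gge.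
  move/eqP : vg; rewrite psumr_eq0 => [/allP/(_ j0)|j _]; last first.
    by rewrite pmulr_rge0// leNgt.
  by rewrite mem_index_enum mulf_eq0 (gt_eqF (vgt0 _)) (negPf gj0) => /(_ isT).
(* Below this size a perturbation of c along e keeps the signs at p and q. *)
have [eps eps0 [epsp epsq]] : exists2 eps : R, 0 < eps &
    eps * `|e p 0| < g p /\ eps * `|e q 0| < - g q.
  pose M := 1 + `|e p 0| + `|e q 0|.
  have := normr_ge0 (e p 0); have := normr_ge0 (e q 0) => eq0 ep0.
  have M0 : 0 < M by rewrite /M; lra.
  pose m := Num.min (g p) (- g q).
  have m0 : 0 < m by rewrite lt_min gp oppr_gt0.
  exists (m / M); first by rewrite divr_gt0.
  split; rewrite mulrAC ltr_pdivrMr//.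
  - apply: (@lt_le_trans _ _ (m * M)); first by rewrite ltr_pM2l// /M; lra.
    by rewrite ler_pM2r// ge_min lexx.
  - apply: (@lt_le_trans _ _ (m * M)); first by rewrite ltr_pM2l// /M; lra.
    by rewrite ler_pM2r// ge_min lexx orbT.
pose g' (j : 'I_k.+1) := (-1) ^+ j * e j 0.
have pat (d : R) : `|d| = eps -> exists2 h : 'I_k -> 'I_k.+1, increasing h &
    forall i : 'I_k, 0 < d * ((-1) ^+ i * (c (h i) 0 + d * e (h i) 0)).
  move=> dE; have d0 : d != 0 by rewrite -normr_gt0 dE.
  have [|i|h hh alth] := VN (d *: (c + d *: e)) k id.
  - by [].
  - rewrite -scalemxAr mulmxDr -scalemxAr Nc add0r Ne !mxE /=.
    rewrite (_ : _ * _ = (d * (-1) ^+ i) ^+ 2); last by ring.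
    by rewrite exprMn sqrr_sign mulr1 lt_def sqrf_eq0 d0 sqr_ge0.
  by exists h => // i; have := alth i; rewrite !mxE mulrCA.
have big (j : 'I_k.+1) (d x : R) : `|d| = eps -> eps * `|e j 0| < x ->
    - x < d * g' j < x.
  by move=> dE; rewrite -ltr_norml normrM dE /g' normrMsign.
case: (ltngtP p q) => [pq|qp|/val_inj pq]; last by move: gp gq; rewrite pq; lra.
- have [|h hh alth] := pat (- eps); first by rewrite normrN gtr0_norm.
  have q1 : q.-1.+1 = q := prednK (leq_ltn_trans (leq0n p) pq).
  have pk : (p < k)%N := leq_trans pq (leq_ord q).
  have qk : (q.-1 < k)%N by rewrite q1 leq_ord.
  have pq1 : (Ordinal pk <= Ordinal qk)%N by rewrite /= -ltnS q1.
  have bp := big p (- eps) (g p); have bq := big q (- eps) (- g q).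
  rewrite normrN gtr0_norm// in bp bq.
  have hq : h (Ordinal qk) = q.
    apply/val_inj; rewrite -[RHS]q1; apply: (increasing_shift hh _ pq1).
    apply/eqP => /val_inj hp; have := alth (Ordinal pk).
    rewrite hp /= mulrDr mulrCA -/(g p) -/(g' p).
    by have /andP[] := bp erefl epsp; rewrite [X in 0 < X]mulNr oppr_gt0 pmulr_rlt0//; lra.
  have := alth (Ordinal qk); rewrite hq /=.
  have -> : (-1) ^+ q.-1 = - (-1) ^+ q :> R.
    by case: (nat_of_ord q) pq => // q' _; rewrite exprS mulN1r opprK.
  rewrite mulNr mulrDr mulrCA -/(g q) -/(g' q).
  by have /andP[] := bq erefl epsq; rewrite [X in 0 < X]mulrNN pmulr_rgt0//; lra.
- have [|h hh alth] := pat eps; first by rewrite gtr0_norm.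
  have p1 : p.-1.+1 = p := prednK (leq_ltn_trans (leq0n q) qp).
  have qk : (q < k)%N := leq_trans qp (leq_ord p).
  have pk : (p.-1 < k)%N by rewrite p1 leq_ord.
  have qp1 : (Ordinal qk <= Ordinal pk)%N by rewrite /= -ltnS p1.
  have bp := big p eps (g p); have bq := big q eps (- g q).
  rewrite gtr0_norm// in bp bq.
  have hp : h (Ordinal pk) = p.
    apply/val_inj; rewrite -[RHS]p1; apply: (increasing_shift hh _ qp1).
    apply/eqP => /val_inj hq; have := alth (Ordinal qk).
    rewrite hq /= mulrDr mulrCA -/(g q) -/(g' q).
    by have /andP[] := bq erefl epsq; rewrite pmulr_rgt0//; lra.
  have := alth (Ordinal pk); rewrite hp /=.
  have -> : (-1) ^+ p.-1 = - (-1) ^+ p :> R.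
    by case: (nat_of_ord p) qp => // p' _; rewrite exprS mulN1r opprK.
  rewrite mulNr mulrDr mulrCA -/(g p) -/(g' p).
  by have /andP[] := bp erefl epsp; rewrite pmulr_rgt0//; lra.
Qed.

(** When the rows are dependent, one of them may be deleted without changing the
    row space; deleting the last column as well restores the shape of the
    matrix. *)
Lemma variation_diminishing_no_alternation k (N : 'M[R]_(k, k.+1)) (v : 'rV_k.+1) :
  variation_diminishing N -> (v <= N)%MS -> ~ alternates_along (v 0) id.
Proof.
elim: k => [|k IH] in N v *; move=> VN vN.
  move=> /(_ ord0); have /submxP[D ->] := vN.
  by rewrite [D]thinmx0 mul0mx mxE mulr0 ltxx.
have [/row_free_no_alternation|] := boolP (row_free N); first exact.
rewrite -kermx_eq0 => /rowV0Pn[u /sub_kermxP uN u0] altv.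
have [i ui] : exists i, u 0 i != 0.
  apply/existsP; apply: contraNT u0; rewrite negb_exists => /forallP u0.
  by apply/eqP/matrixP => i j; rewrite !ord1 mxE; have := u0 j; rewrite negbK => /eqP.
have Nrow : (N <= row' i N)%MS.
  apply/row_subP => j; have [<-|/unlift_some[j' -> _]] := eqVneq i j; last first.
    have -> : row (lift i j') N = row j' (row' i N) by apply/rowP => l; rewrite !mxE.
    exact: row_sub.
  have -> : row i N = - (u 0 i)^-1 *: (\sum_(j < k) u 0 (lift i j) *: row j (row' i N)).
    apply/rowP => l; rewrite !mxE summxE.
    have := congr1 (fun M : 'rV_k.+2 => M 0 l) uN; rewrite !mxE (bigD1_ord i)//= => /eqP.
    rewrite addr_eq0 => /eqP uNl; under eq_bigr do rewrite !mxE.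
    apply: (mulfI ui); rewrite uNl mulrA mulrN mulfV// mulN1r.
    by [].
  by rewrite scalemx_sub// summx_sub// => j' _; rewrite scalemx_sub// row_sub.
pose M := col' ord_max (row' i N).
apply: (IH M (col' ord_max v)); last first.
- by move=> j; have := altv (lift ord_max j); rewrite lift_max /= mxE.
- have /submxP[D ->] := submx_trans vN Nrow; 
  have -> : col' ord_max (D *m row' i N) = D *m M.
    by apply/matrixP => a b; rewrite !mxE; apply: eq_bigr => ? _; rewrite !mxE.
  exact: submxMl.
move=> c m h hh alth.
(* Vectors of the smaller space are completed by a zero, where no sign is found. *)
pose c' : 'cV[R]_k.+2 := \col_j (if unlift ord_max j is Some j' then c j' 0 else 0).
have c'l j : c' (lift ord_max j) 0 = c j 0 by rewrite mxE liftK.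
have Mc j : (M *m c) j 0 = (N *m c') (lift i j) 0.
  rewrite !mxE [RHS]big_ord_recr /=.
  rewrite [c' ord_max _]mxE unlift_none mulr0 addr0.
  apply: eq_bigr => l _; rewrite -c'l !mxE.
  have -> // : widen_ord (leqnSn k.+1) l = lift ord_max l.
  exact/val_inj/esym/lift_max.
have [|l|h' hh' alth'] := VN c' m (lift i \o h).
- by move=> a b ab /=; rewrite ltnNge leq_bump2 -ltnNge; exact: hh.
- by have := alth l; rewrite /= Mc.
pose h'' l := odflt ord0 (unlift ord_max (h' l)).
have h'E l : h' l = lift ord_max (h'' l).
  have := alth' l; rewrite mxE /h''; case: unliftP => [j -> //|_].
  by rewrite mulr0 ltxx.
exists h'' => [a b ab|a]; last by have := alth' a; rewrite h'E c'l.
by have := hh' _ _ ab; rewrite !h'E !lift_max.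
Qed.

End variation_diminishing_matrices.

(** * Integrals against mixtures of measures *)
Section mixture.
Context d1 d2 (T1 : measurableType d1) (T2 : measurableType d2) (R : realType).
Variables (m1 : {measure set T1 -> \bar R}) (D : set T1) (mD : measurable D).
Variables (k : T1 -> {measure set T2 -> \bar R}) (m2 : {measure set T2 -> \bar R}).
Import HBNNSimple.
Hypothesis mk : forall B, measurable B -> measurable_fun [set: T1] (k ^~ B).
Hypothesis m2E : forall B, measurable B -> (m2 B = \int[m1]_(x in D) k x B)%E.
Local Open Scope ereal_scope.

(** Both sides are limits along the same simple functions approximating [f], for
    which the equality is the hypothesis on [m2]. *)
Lemma ge0_integral_mixture (f : T2 -> \bar R) :
  (forall y, 0 <= f y) -> measurable_fun [set: T2] f ->
  \int[m2]_y f y = \int[m1]_(x in D) \int[k x]_y f y.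
Proof.
move=> f0 mf; pose f_ := nnsfun_approx measurableT mf.
have f_cvg y : limn (fun n => (f_ n y)%:E) = f y.
  by apply/cvg_lim => //; exact: (cvg_nnsfun_approx measurableT mf (fun y _ => f0 y)).
have f_nd n m y : (n <= m)%N -> (f_ n y)%:E <= (f_ m y)%:E.
  by move=> nm; rewrite lee_fin; exact/lefP/nd_nnsfun_approx.
have mf_ n : measurable_fun [set: T2] (fun y => (f_ n y)%:E).
  exact/measurable_EFinP/measurable_funP.
have f_0 n y : 0 <= (f_ n y)%:E by rewrite lee_fin.
have fE (m : {measure set T2 -> \bar R}) :
    \int[m]_y f y = limn (fun n => \int[m]_y (f_ n y)%:E).
  rewrite -monotone_convergence//; last by move=> y _ n n' /f_nd.
  exact: eq_integral.
have mint n : measurable_fun [set: T1] (fun x => \int[k x]_y (f_ n y)%:E).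
  exact: measurable_fun_integral_kernel.
transitivity (\int[m1]_(x in D) limn (fun n => \int[k x]_y (f_ n y)%:E)).
  rewrite monotone_convergence//; last 3 first.
  - by move=> n; exact: measurable_funTS.
  - by move=> n x _; exact: integral_ge0.
  - by move=> x _ n n' nn'; apply: ge0_le_integral => // y _; exact: f_nd.
  rewrite fE; congr (limn _); apply/funext => n.
  rewrite integralT_nnsfun sintegralE.
  under [RHS]eq_integral do rewrite integralT_nnsfun sintegralE.
  have mfn r : measurable (f_ n @^-1` [set r]).
    by rewrite -[X in measurable X]setTI; exact: measurable_funP.
  rewrite ge0_integral_fsum//; last 2 first.
  - by move=> r; apply: measurable_funTS; apply: measurable_funeM; exact: mk.
  - move=> r x _; have [r0|r0] := leP 0%R r; first by rewrite mule_ge0.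
    by rewrite preimage_nnfun0// measure0 mule0.
  apply: eq_fsbigr => r _; rewrite m2E//.
  have [r0|r0] := leP 0%R r.
    by rewrite ge0_integralZl//; apply: measurable_funTS; exact: mk.
  rewrite preimage_nnfun0// !integral0_eq ?mule0// => x _; rewrite measure0//.
  by rewrite mule0.
by apply: eq_integral => x _; rewrite fE.
Qed.

Lemma integral_mixture (f : T2 -> \bar R) : m2.-integrable [set: T2] f ->
  \int[m2]_y f y = \int[m1]_(x in D) \int[k x]_y f y.
Proof.
move=> /integrableP[mf If].
have mp := measurable_funepos mf; have mn := measurable_funeneg mf.
have part (g : T2 -> \bar R) : (forall y, 0 <= g y) -> measurable_fun [set: T2] g ->
    (forall y, g y <= `|f y|) -> m1.-integrable D (fun x => \int[k x]_y g y).
  move=> g0 mg gf; apply/integrableP; split.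
    by apply: measurable_funTS; exact: measurable_fun_integral_kernel.
  under eq_integral do rewrite gee0_abs ?integral_ge0//.
  rewrite -ge0_integral_mixture//; apply: le_lt_trans If.
  by apply: ge0_le_integral => //; exact: measurableT_comp.
rewrite integralE !ge0_integral_mixture//.
rewrite -integralB//=.
- by apply: eq_integral => x _; rewrite [in RHS]integralE.
- by apply: part => // y; rewrite -/((abse \o f) y) fune_abse leeDl.
- by apply: part => // y; rewrite -/((abse \o f) y) fune_abse leeDr.
Qed.

End mixture.

(** * Borel sets and functions vanishing at infinity *)
Section borel_spaces.
Context (T : ptopologicalType) (R : realType).

Lemma open_borel (U : set T) : open U -> measurable (U : set (borel T)).
Proof. exact: sub_sigma_algebra. Qed.

Lemma closed_borel (C : set T) : closed C -> measurable (C : set (borel T)).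
Proof.
move=> /closed_openC oC; rewrite -[C]setCK; apply: measurableC; exact: open_borel.
Qed.

Lemma continuous_measurable_real (f : T -> R) : continuous f ->
  measurable_fun [set: borel T] (f : borel T -> R).
Proof.
move=> /continuousP cf; apply: (measurability _ (RGenOpens.measurableE R)).
move=> _ [_ [a [b ->] <-]]; rewrite setTI; apply: open_borel.
exact/cf/interval_open.
Qed.

End borel_spaces.

Section C0_functions.
Context (R : realType) (X : topologicalType).

Lemma C0_bounded (f : X -> R) : C0 f -> exists2 M, 0 < M & forall x, `|f x| <= M.
Proof.
move=> [cf /(_ 1 ltr01)[K cK K1]].
have /compact_bounded[M [_ bM]] : compact (f @` K).
  by apply: continuous_compact => //; exact: continuous_subspaceT.
exists (`|M| + 1); first by rewrite ltr_wpDl.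
move=> x; have [Kx|nKx] := pselect (K x).
  by apply: (bM (`|M| + 1)); [rewrite (le_lt_trans (ler_norm _))// ltrDl|exists x].
by rewrite (le_trans (ltW (K1 _ nKx)))// lerDr.
Qed.

Lemma C0_cst0 : C0 ((fun=> 0) : X -> R).
Proof.
split; first exact: cst_continuous.
by move=> e e0; exists set0 => [|x _]; [exact: compact0|rewrite normr0].
Qed.

Lemma C0_axpy (a : R) (f g : X -> R) : C0 f -> C0 g -> C0 (fun x => a * f x + g x).
Proof.
move=> [cf f0] [cg g0]; split.
  by move=> x; apply: cvgD; [apply: cvgMr; exact: cf|exact: cg].
move=> e e0; pose M := `|a| + 1.
have M0 : 0 < M by rewrite ltr_wpDl.
have eM : 0 < e / 2 / M by rewrite !divr_gt0.
have e2 : 0 < e / 2 by rewrite divr_gt0.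
have [K cK Kf] := f0 _ eM; have [L cL Lg] := g0 _ e2.
exists (K `|` L); first exact: compactU.
move=> x /not_orP[/Kf fx /Lg gx]; rewrite (le_lt_trans (ler_normD _ _))//.
rewrite normrM [ltRHS](splitr e) ler_ltD// (@le_trans _ _ (M * (e / 2 / M)))//.
  by apply: ler_pM => //; [rewrite /M lerDl|exact: ltW].
by rewrite mulrCA divff ?gt_eqF// mulr1.
Qed.

End C0_functions.

(** * One-point compactification and Markov property *)
Section one_point_extension.
Context (R : realType) (X : ptopologicalType).
Local Notation opc := (one_point_compactification X).

Definition extend0 (f : X -> R) (w : opc) : R := if w is Some x then f x else 0.

(** A total inverse of [Some], through which measures are carried back from the
    compactification to E. *)
Definition retract (w : borel opc) : borel X := if w is Some x then x else point.

Lemma extend0_continuous_at (Y : topologicalType) (f : opc -> Y) (x : X) :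
  {for x, continuous (f \o (Some : X -> opc))} -> {for Some x, continuous f}.
Proof. by move=> fx U /fx. Qed.

(** At infinity the neighbourhoods are the complements of closed compact sets;
    [{x | e <= |f x|}] is one of them. *)
Lemma C0_extend0_continuous (f : X -> R) : C0 f -> continuous (extend0 f : opc -> R).
Proof.
move=> [cf f0] [x|]; first exact/extend0_continuous_at/cf.
move=> U /= /nbhs_ballP[e /= e0 eU]; have [K cK Ke] := f0 _ e0.
exists [set x | e <= `|f x|]; last first.
  move=> _ [[x /= /negP xe <-]|->]; apply: eU; rewrite /ball /= sub0r normrN ?normr0//.
  by rewrite ltNge.
have cl : closed [set x | e <= `|f x|].
  apply: (@closed_comp _ _ (fun x => `|f x|) [set r | e <= r]); last exact: closed_ge.
  by move=> x _; apply: cvg_norm; exact: cf.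
split => //; apply: subclosed_compact cK _ => // x /=.
by apply: contraPP => /Ke; rewrite ltNge => /negP.
Qed.

Lemma measurable_Some (B : set (borel X)) : measurable B ->
  measurable (Some @` B : set (borel opc)).
Proof.
have mT : measurable (Some @` [set: X] : set (borel opc)).
  by apply: open_borel; apply: one_point_compactification_open_some; exact: openT.
apply: (@smallest_sub _ (sigma_algebra setT) open
   [set B | measurable (Some @` B : set (borel opc))]).
- split => [|A mA|A mA] /=; first by rewrite image_set0; exact: measurable0.
  + have -> : Some @` ([set: X] `\` A) = (Some @` [set: X]) `\` (Some @` A).
      apply/seteqP; split => [_ [x [_ nAx] <-]|_ [[x _ <-] nA]].
        by split; [exists x|move=> [y Ay [yx]]; apply: nAx; rewrite -yx].
      by exists x => //; split => // Ax; apply: nA; exists x.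
    exact: measurableD.
  + by rewrite image_bigcup; apply: bigcup_measurable => n _; exact: mA.
- by move=> U oU; apply: open_borel; exact: one_point_compactification_open_some.
Qed.

Lemma measurable_retract : measurable_fun [set: borel opc] retract.
Proof.
move=> _ B mB; rewrite setTI.
have -> : retract @^-1` B = Some @` B `|` (if `[< B point >] then ~` (Some @` setT) else set0).
  apply/seteqP; split => [[x|]|w []] /=.
  - by move=> Bx; left; exists x.
  - by move=> Bp; right; rewrite asboolT// => -[].
  - by move=> [x Bx <-].
  - by case: asboolP => //; case: w => [x|] //= _ []; exists x.
apply: measurableU; first exact: measurable_Some.
by case: asboolP => _ //; apply: measurableC; exact: measurable_Some.
Qed.

End one_point_extension.

Section markov.
Context (R : realType) (I : set R) (I0 : I !=set0).
Local Notation E := (spacetime I0).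
Local Notation Ept := (spacetime_pt I0).
Context (T : R -> (E -> R) -> E -> R) (P : R -> R.-spker E ~> E).
Hypotheses (T_semigroup : C0_contraction_semigroup T) (P_T : represents T P).
Context d (Omega : measurableType d).
Variables (Pr : Ept -> probability Omega R) (W : R -> Omega -> Ept).
Hypothesis W_markov : cadlag_strong_Markov (extended_kernel P) Pr W.

Let mW (r : R) (r0 : 0 <= r) : measurable_fun [set: Omega] (W r) :=
  csM_measurable W_markov r0.

Lemma natural_filtration_measurable r A : 0 <= r -> natural_filtration W r A ->
  measurable A.
Proof.
move=> r0; apply: (@smallest_sub _ (sigma_algebra setT)).
  exact: sigma_algebra_measurable.
move=> _ [u [B [/andP[u0 _] mB ->]]].
by rewrite -[X in measurable X]setTI; exact: mW.
Qed.

(** The strong Markov property at a constant time. *)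
Lemma simple_markov w r h A B : 0 <= r -> 0 <= h -> natural_filtration W r A ->
  measurable B ->
  (Pr w (A `&` [set o | B (W (r + h) o)]) =
   \int[Pr w]_(o in A) extended_kernel P h (W r o) B)%E.
Proof.
move=> r0 h0 FA mB.
have mA := natural_filtration_measurable r0 FA.
have := @csM_strong_Markov _ _ _ _ _ _ _ W_markov w (cst r%:E) A h B.
have -> : [set o : Omega | (cst r%:E o < +oo)%E] = setT.
  by apply/seteqP; split => // o _ /=; rewrite ltry.
rewrite setIT /=.
have -> : [set o | (r%:E < +oo)%E /\ B (W (r + h) o)] = [set o | B (W (r + h) o)].
  by apply/seteqP; split => [z []|z /= Bz] //; split => //; rewrite ltry.
apply => //.
- split => [z|t t0]; first by rewrite lee_fin.
  have [rt|tr] := ltP r t.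
    rewrite (_ : [set _ | _] = setT).
      by rewrite -setC0; apply: sigma_algebraC; exact: sigma_algebra0.
    by apply/seteqP; split => // o _ /=; rewrite lte_fin.
  rewrite (_ : [set _ | _] = set0); first exact: sigma_algebra0.
  by apply/seteqP; split => // o /=; rewrite lte_fin ltNge tr.
- split => // t t0; have [rt|tr] := ltP r t.
    rewrite (_ : [set _ | _] = setT) ?setIT.
      apply: sub_sigma_algebra2 FA => _ [u [B' [/andP[u0 ur] mB' ->]]].
      by exists u, B'; split => //; rewrite u0 (le_trans ur)// ltW.
    by apply/seteqP; split => // o _ /=; rewrite lte_fin.
  rewrite (_ : [set o | _] = set0) ?setI0; first exact: sigma_algebra0.
  by apply/seteqP; split => // o /=; rewrite lte_fin ltNge tr.
Qed.

(** The extended kernel seen from E, where it has no mass at infinity. *)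
Definition alive_kernel h (w : Ept) : {measure set E -> \bar R} :=
  if w is Some e then P h e else mzero.

Lemma measurable_alive_kernel h B : measurable B ->
  measurable_fun [set: Ept] (alive_kernel h ^~ B).
Proof.
move=> mB.
have -> : alive_kernel h ^~ B = ((fun w => P h (retract w) B) \_ (Some @` [set: E]))%E.
  apply/funext => -[e|]; rewrite /patch.
    by rewrite mem_set//=; exists e.
  by rewrite memNset//= => -[].
apply/(measurable_restrictT _ (measurable_Some measurableT)).
apply: measurable_funTS.
exact: (measurableT_comp (measurable_kernel (P h) B mB) (@measurable_retract _)).
Qed.

Lemma extended_kernel_Some h w (B : set E) :
  extended_kernel P h w (Some @` B) = alive_kernel h w B.
Proof.
case: w => [e|] /=; last by rewrite diracE memNset//; case.
rewrite diracE memNset ?mule0 ?adde0; last by case.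
by congr (P h e _); apply/seteqP; split => [x [y By [<-]]//|x Bx]; exists x.
Qed.

Lemma measurable_extend0 (f : E -> R) r : 0 <= r -> C0 f ->
  measurable_fun [set: Omega] (fun o => extend0 f (W r o)).
Proof.
move=> r0 cf; apply: (measurableT_comp (continuous_measurable_real _) (mW r0)).
exact: C0_extend0_continuous.
Qed.

Lemma extend0_integrable (mu : {finite_measure set Omega -> \bar R}) (f : E -> R) r A :
  0 <= r -> C0 f -> measurable A ->
  mu.-integrable A (fun o => (extend0 f (W r o))%:E).
Proof.
move=> r0 cf mA; apply: measurable_bounded_integrable => //.
- by rewrite -ge0_fin_numE// fin_num_measure.
- exact/measurable_funTS/measurable_extend0.
- have [M M0 fM] := C0_bounded cf; exists M; split; first exact: num_real.
  move=> x Mx o _ /=; apply: le_trans (ltW Mx).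
  by rewrite /extend0; case: (W r o) => [e|]; [exact: fM|rewrite normr0 ltW].
Qed.

(** Both sides are the integral of [g] against the measure
    [B |-> Pr w (A `&` [W_(r+h) in B])] on E, written as a mixture of Dirac masses
    and as a mixture of the kernels of the semigroup. *)
Lemma markov_C0 w r h A (g : E -> R) : 0 <= r -> 0 <= h -> natural_filtration W r A ->
  C0 g ->
  (\int[Pr w]_(o in A) (extend0 g (W (r + h) o))%:E =
   \int[Pr w]_(o in A) (extend0 (T h g) (W r o))%:E)%E.
Proof.
move=> r0 h0 FA cg; have rh0 : 0 <= r + h by exact: addr_ge0.
have mA := natural_filtration_measurable r0 FA.
have mS : measurable (Some @` [set: E] : set Ept) by exact: measurable_Some.
pose A' := A `&` W (r + h) @^-1` (Some @` [set: E]).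
have mA' : measurable A'.
  by apply: measurableI => //; rewrite -[X in measurable X]setTI; exact: mW.
pose phi o := retract (W (r + h) o).
have mphi : measurable_fun [set: Omega] phi.
  exact: measurableT_comp (@measurable_retract _) (mW rh0).
have @m2 : {measure set E -> \bar R}.
  by refine (pushforward (mrestr (Pr w) mA') phi).
have m2E B : m2 B = Pr w (phi @^-1` B `&` A') by [].
have m2_markov B : measurable B -> (m2 B = \int[Pr w]_(o in A) alive_kernel h (W r o) B)%E.
  move=> mB; have := simple_markov w r0 h0 FA (measurable_Some mB).
  rewrite m2E => AB.
  transitivity (Pr w (A `&` [set o | [set Some e | e in B] (W (r + h) o)])).
    congr (Pr w _); apply/seteqP; split => o /=.
      by rewrite /phi => -[+ [Ao [e _ We]]]; rewrite -We /= => Be; split => //; exists e.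
    by move=> [Ao [e Be We]]; rewrite /phi -We /=; split => //; split => //; exists e.
  by rewrite AB; apply: eq_integral => o _; rewrite extended_kernel_Some.
have m2_dirac B : measurable B -> (m2 B = \int[Pr w]_(o in A') \d_(phi o) B)%E.
  move=> mB; rewrite m2E -integral_indic//.
  by rewrite -[X in measurable X]setTI; exact: (mphi measurableT B mB).
have m2g : m2.-integrable [set: E] (EFin \o g).
  apply: measurable_bounded_integrable => //.
  - rewrite m2E -ge0_fin_numE// fin_num_measure//.
    by apply: measurableI => //; rewrite preimage_setT.
  - exact: (continuous_measurable_real cg.1).
  - have [M M0 gM] := C0_bounded cg; exists M; split; first exact: num_real.
    by move=> x Mx e _; exact: le_trans (gM e) (ltW Mx).
have mkW B : measurable B -> measurable_fun [set: Omega] (fun o => alive_kernel h (W r o) B).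
  by move=> mB; exact: (measurableT_comp (measurable_alive_kernel h mB) (mW r0)).
have mdirac B : measurable B -> measurable_fun [set: Omega] (fun o => \d_(phi o) B : \bar R).
  by move=> mB; apply/measurable_EFinP; exact: (measurableT_comp (measurable_indic mB) mphi).
have := integral_mixture mA mkW m2_markov m2g.
rewrite (integral_mixture mA' mdirac m2_dirac m2g) => int2.
transitivity (\int[Pr w]_(o in A') \int[\d_(phi o)]_e (g e)%:E)%E.
  rewrite integral_mkcond [RHS]integral_mkcond; apply: eq_integral => o _.
  rewrite /patch; have [Ao|nAo] := boolP (o \in A); last first.
    rewrite memNset// => -[Ao _]; by move: nAo; rewrite mem_set.
  case Wo : (W (r + h) o) => [e|].
    rewrite mem_set; last by split; [exact: set_mem|exists e].
    rewrite integral_dirac//; last first.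
      by apply/measurable_EFinP; exact: (continuous_measurable_real cg.1).
    by rewrite diracT mul1e /phi Wo.
  by rewrite memNset// => -[_ []] e _; rewrite Wo.
rewrite int2; apply: eq_integral => o _; rewrite /alive_kernel; case: (W r o) => [e|] /=.
  by rewrite P_T.
by rewrite integral_measure_zero.
Qed.

End markov.

(** * Coordinates of space-time *)
Section coordinates.
Context (R : realType).

Lemma subline_val_continuous (A : set R) (A0 : A !=set0) :
  continuous (@subline_val R A A0).
Proof. exact: initial_continuous. Qed.

Lemma subline_val_inj (A : set R) (A0 : A !=set0) : injective (@subline_val R A A0).
Proof. by move=> x y; exact: val_inj. Qed.

Variables (I : set R) (I0 : I !=set0).

Lemma time_continuous : continuous (fun e : time_space I0 => subline_val e.1).
Proof.
move=> e; apply: (@continuous_comp _ _ _ fst (@subline_val _ _ _)); first exact: cvg_fst.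
exact: subline_val_continuous.
Qed.

Lemma measurable_time_neq (r : R) :
  measurable ([set e | subline_val e.1 <> r] : set (spacetime I0)).
Proof.
apply: open_borel; rewrite -[X in open X]setCK openC.
rewrite (_ : ~` _ = (fun e : time_space I0 => subline_val e.1) @^-1` [set r]).
  by apply: closed_comp => [x _|]; [exact: time_continuous|exact: closed_eq].
by apply/seteqP; split => e /=; [exact: contrapT|move=> eE; apply].
Qed.

Lemma space_continuous : continuous (fun e : time_space I0 => subline_val e.2).
Proof.
move=> e; apply: (@continuous_comp _ _ _ snd (@subline_val _ _ _)); first exact: cvg_snd.
exact: subline_val_continuous.
Qed.

Lemma closed_point (e : time_space I0) : closed [set e].
Proof.
have -> : [set e] = (fun x : time_space I0 => subline_val x.1) @^-1` [set subline_val e.1]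
   `&` (fun x : time_space I0 => subline_val x.2) @^-1` [set subline_val e.2].
  apply/seteqP; split => [x ->//|x [/= /subline_val_inj x1 /subline_val_inj x2]].
  by case: x e x1 x2 => [? ?] [? ?] /= -> ->.
by apply: closedI; apply: closed_comp => [x _|];
  [exact: time_continuous|exact: closed_eq|exact: space_continuous|exact: closed_eq].
Qed.

Lemma closed_point_pt (e : time_space I0) :
  closed [set (Some e : one_point_compactification (time_space I0))].
Proof.
rewrite -openC openE => -[x|] /= xe; last first.
  exists [set e]; first by split; [exact: compact_set1|exact: closed_point].
  move=> _ [[x /= nx <-] [xe']|-> //]; exact: nx.
have : (~` [set e]) x by move=> xE; apply: xe; rewrite xE.
have /closed_openC := @closed_point e; rewrite openE => /[apply] nx.
have := @one_point_compactification_some_nbhs _ x _ nx.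
by apply: filterS => _ [y ye <-] [].
Qed.

End coordinates.

(** * Paths along which the semigroup stays positive *)
Section survival.
Context (R : realType) (I : set R) (I0 : I !=set0).
Local Notation E := (spacetime I0).
Local Notation Ept := (spacetime_pt I0).
Context (T : R -> (E -> R) -> E -> R) (P : R -> R.-spker E ~> E).
Hypotheses (T_semigroup : C0_contraction_semigroup T) (P_T : represents T P).
Context d (Omega : measurableType d).
Variables (Pr : Ept -> probability Omega R) (W : R -> Omega -> Ept).
Hypothesis W_markov : cadlag_strong_Markov (extended_kernel P) Pr W.

(** Points of E are closed in the compactification, so that the event is
    measurable and its probability one means almost surely. *)
Lemma starts_at (w : E) : {ae Pr (Some w), forall o, W 0 o = Some w}.
Proof.
have mS : measurable [set o | W 0 o = Some w].
  have := csM_measurable W_markov (lexx 0).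
  move=> /(_ measurableT [set (Some w : Ept)]); rewrite setTI; apply.
  by apply: closed_borel; exact: closed_point_pt.
exists (~` [set o | W 0 o = Some w]); split => //; first exact: measurableC.
rewrite probability_setC// (csM_start W_markov) subee//.
Qed.

Variables (F : E -> R) (a delta : R) (w : E).
Hypotheses (cF : C0 F) (a0 : 0 <= a).

Definition value r o := extend0 (T (a - r) F) (W r o).

Section grid.
Variables (r : nat -> R) (N : nat).
Hypotheses (r_nd : nondecreasing_seq r) (r0 : r 0%N = 0) (rN : r N = a).

Definition above j := [set o | forall i, (i < j)%N -> delta < value (r i) o].

Let r_ge0 j : 0 <= r j. Proof. by rewrite -r0 r_nd. Qed.

Let r_le j : (j <= N)%N -> 0 <= a - r j. Proof. by move=> jN; rewrite subr_ge0 -rN r_nd. Qed.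

Lemma aboveS j : above j.+1 = above j `&` [set o | delta < value (r j) o].
Proof.
apply/seteqP; split => o.
  by move=> oj; split => [i ij|/=]; apply: oj => //; exact: ltnW.
by move=> [oj ojj] i; rewrite ltnS leq_eqVlt => /predU1P[->//|/oj].
Qed.

Lemma above_filtration j s : (j <= N.+1)%N -> (forall i, (i < j)%N -> r i <= s) ->
  natural_filtration W s (above j).
Proof.
elim: j => [|j IH] jN js.
  rewrite (_ : above 0 = setT); last by apply/seteqP; split.
  by rewrite -setC0; apply: sigma_algebraC; exact: sigma_algebra0.
rewrite aboveS; apply: (@measurableI _ (g_sigma_algebraType _)).
  by apply: IH => [|i ij]; [exact: ltnW|rewrite js// ltnW].
apply: sub_sigma_algebra.
exists (r j), (extend0 (T (a - r j) F) @^-1` `]delta, +oo[); split.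
- by rewrite r_ge0 js.
- rewrite -[X in measurable X]setTI.
  apply: (continuous_measurable_real (C0_extend0_continuous _)) => //.
  by apply: C0sg_C0 T_semigroup _ _ _ cF; exact: r_le.
- by apply/seteqP; split => o /=; rewrite in_itv /= andbT.
Qed.

Let mabove j : (j <= N.+1)%N -> measurable (above j).
Proof.
move=> jN; apply: (natural_filtration_measurable W_markov (a0 : 0 <= a)).
by apply: above_filtration => // i ij; rewrite -rN r_nd// -ltnS (leq_trans ij).
Qed.

Let C0value j : (j <= N)%N -> C0 (T (a - r j) F).
Proof. by move=> jN; apply: C0sg_C0 T_semigroup _ _ _ cF; exact: r_le. Qed.

Let iv (h : R) (G : E -> R) A : 0 <= h -> C0 G -> measurable A ->
  (Pr (Some w)).-integrable A (fun o => (extend0 G (W h o) - delta)%:E).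
Proof.
move=> h0 cG mA; under eq_fun do rewrite EFinB.
apply: integrableB => //; first exact: (extend0_integrable W_markov).
exact: finite_measure_integrable_cst.
Qed.

Local Notation Ex j k :=
  (\int[Pr (Some w)]_(o in above j) (value (r k) o - delta)%:E)%E.

(** The outcomes lost from [above j] to [above j.+1] have [value <= delta], so
    they contribute a nonpositive amount. *)
Lemma grid_cut j : (j <= N)%N -> (Ex j j <= Ex j.+1 j)%E.
Proof.
move=> jN; have mj := mabove (leqW jN); have mj1 := mabove (jN : (j.+1 <= N.+1)%N).
have sub : above j.+1 `<=` above j by rewrite aboveS; exact: subIsetl.
have mD : measurable (above j `\` above j.+1) by exact: measurableD.
have intA A : measurable A ->
    (Pr (Some w)).-integrable A (fun o => (value (r j) o - delta)%:E).
  by move=> mA; apply: iv => //; exact: C0value.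
rewrite -{1}(setDUK sub) integral_setU//; last 2 first.
- by apply: measurable_int (intA _ _); exact: measurableU.
- by rewrite disj_set_sym; apply/disj_setPS => o [[]].
rewrite geeDl//.
have <- : (\int[Pr (Some w)]_(o in above j `\` above j.+1) cst 0 o = 0)%E.
  exact: integral0.
apply: le_integral => //; first exact: intA; first exact: integrable0.
move=> o /set_mem[oj noj1]; rewrite lee_fin subr_le0 leNgt; apply/negP => dv.
by apply: noj1; rewrite aboveS.
Qed.

Lemma grid_markov j : (j < N)%N -> Ex j.+1 j = Ex j.+1 j.+1.
Proof.
move=> jN; have mj1 := mabove (ltnW jN : (j.+1 <= N.+1)%N).
have h0 : 0 <= r j.+1 - r j by rewrite subr_ge0 r_nd.
have C1 := C0value jN; have C2 := C0value (ltnW jN).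
have cst_int A : measurable A -> (Pr (Some w)).-integrable A (cst delta%:E).
  by move=> mA; exact: finite_measure_integrable_cst.
under eq_integral do rewrite EFinB.
under [RHS]eq_integral do rewrite EFinB.
rewrite !integralB//; [|exact: (extend0_integrable W_markov)|exact: cst_int
  |exact: (extend0_integrable W_markov)|exact: cst_int].
congr (_ - _)%E; have FA : natural_filtration W (r j) (above j.+1).
  by apply: above_filtration => [|i ij]; [exact: ltnW|exact: r_nd].
have := markov_C0 P_T W_markov (Some w) (r_ge0 j) h0 FA C1.
rewrite subrKC => ->; apply: eq_integral => o _; rewrite /value; congr (extend0 _ _)%:E.
rewrite -(C0sg_add T_semigroup)//; last exact: r_le.
by congr (T _ F); ring.
Qed.

(** Discarding the outcomes where the martingale is at most [delta] never
    decreases the expectation of its excess over [delta]; at the last time the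
    excess is at most [C].  The bound does not depend on the grid, which allows
    the passage to all dyadic times. *)
Lemma grid_bound C : 0 <= C -> (forall e, `|F e| <= C) -> 0 <= delta ->
  ((T a F w - delta)%:E <= C%:E * Pr (Some w) (above N.+1))%E.
Proof.
move=> C0' FC d0.
have Ex0 : Ex 0 0 = (T a F w - delta)%:E.
  rewrite (_ : above 0 = setT); last by apply/seteqP; split.
  transitivity (\int[Pr (Some w)]_o (cst (T a F w - delta)%:E o))%E; last first.
    rewrite integral_cst//.
    transitivity ((T a F w - delta)%:E * 1)%E; last by rewrite mule1.
    by congr (_ * _)%E; exact: probability_setT.
  apply: ae_eq_integral => //.
  - by apply: measurable_int (iv _ _ _) => //; exact: C0value.
  - apply: filterS (starts_at w) => o Wo _.
    by rewrite /value r0 subr0 Wo.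
have ExN j : (j <= N)%N -> (Ex 0 0 <= Ex j j)%E.
  elim: j => // j IH jN; apply: le_trans (IH (ltnW jN)) _.
  by rewrite -grid_markov//; apply: grid_cut; exact: ltnW.
rewrite -Ex0; apply: le_trans (ExN N (leqnn _)) _.
apply: le_trans (grid_cut (leqnn _)) _.
rewrite -integral_cst; last exact: mabove.
apply: le_integral.
- exact: mabove.
- by apply: iv => //; [exact: C0value|exact: mabove].
- by apply: finite_measure_integrable_cst; exact: mabove.
move=> o _; rewrite lee_fin lerBlDr /value rN subrr.
apply: le_trans (ler_norm _) _; apply: (@le_trans _ _ C); last by rewrite lerDl.
by rewrite (C0sg_0 T_semigroup)// /extend0; case: (W a o) => [e|]; rewrite ?normr0.
Qed.

End grid.
End survival.

Lemma exists_of_ae d (Omega : measurableType d) (R : realType)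
  (mu : {measure set Omega -> \bar R}) (A : set Omega) (G : Omega -> Prop) :
  measurable A -> (0 < mu A)%E -> {ae mu, forall o, G o} -> exists2 o, A o & G o.
Proof.
move=> mA A0 aeG; apply: contrapT => nAG; move: A0.
rewrite measure_negligible ?ltxx//; apply: negligibleS aeG.
by move=> o Ao Go; apply: nAG; exists o.
Qed.

Section dyadic_grid.
Variables (R : realType) (a : R).

Definition dyadic (k i : nat) : R := a * i%:R / 2 ^+ k.

Lemma dyadic0 k : dyadic k 0 = 0.
Proof. by rewrite /dyadic mulr0 mul0r. Qed.

Lemma dyadic_last k : dyadic k (2 ^ k) = a.
Proof. by rewrite /dyadic natrX mulfK// expf_neq0. Qed.

Lemma dyadic_double k i : dyadic k.+1 (i.*2) = dyadic k i.
Proof.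
rewrite /dyadic -mul2n natrM exprS; have : (2 : R) ^+ k != 0 by rewrite expf_neq0.
by move=> k0; field.
Qed.

Hypothesis a0 : 0 < a.

Lemma dyadic_nd k : nondecreasing_seq (dyadic k).
Proof.
move=> i j ij; rewrite /dyadic ler_pM2r ?invr_gt0 ?exprn_gt0// ler_pM2l//.
by rewrite ler_nat.
Qed.

Lemma dyadic_le k i : (i <= 2 ^ k)%N -> 0 <= dyadic k i <= a.
Proof.
by move=> ik; have := dyadic_nd k (leq0n i); have := dyadic_nd k ik;
  rewrite dyadic0 dyadic_last => -> ->.
Qed.

Lemma dyadic_dense (r e : R) : 0 <= r <= a -> 0 < e ->
  exists k i, (i <= 2 ^ k)%N /\ `|r - dyadic k i| < e.
Proof.
move=> /andP[r0 ra] e0.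
have [k ake] : exists k : nat, a / 2 ^+ k < e.
  have [k ak] : exists k : nat, a / e < k%:R.
    exists (Num.truncn (a / e)).+1; exact: truncnS_gt.
  exists k; rewrite ltr_pdivrMr ?exprn_gt0// mulrC -ltr_pdivrMr//.
  apply: lt_trans ak _; rewrite -natrX ltr_nat; exact: ltn_expl.
have p0 : 0 < 2 ^+ k :> R by rewrite exprn_gt0.
pose i := Num.truncn (r / a * 2 ^+ k).
have x0 : 0 <= r / a * 2 ^+ k by rewrite mulr_ge0 ?divr_ge0// ltW.
have /andP[ix xi] := truncn_itv x0; rewrite -/i in ix xi.
exists k, i; split.
  rewrite -(ler_nat R) natrX; apply: le_trans ix _.
  by rewrite -[leRHS]mul1r ler_pM2r// ler_pdivrMr// mul1r.
apply: le_lt_trans ake.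
rewrite /dyadic; move: (2 ^+ k : R) p0 ix xi => p p0 ix xi.
have rE : r = a / p * (r / a * p).
  by field; rewrite !gt_eqF.
have ap0 : 0 <= a / p by rewrite divr_ge0// ltW.
rewrite {1}rE [a * _ / p]mulrAC -mulrBr normrM (ger0_norm ap0).
rewrite -[leRHS]mulr1 ler_wpM2l// ger0_norm ?subr_ge0//.
by rewrite lerBlDr addrC natr1; exact: ltW.
Qed.

Lemma le_of_le_dyadic (u : R -> R) (c : R) : {within `[0, a], continuous u} ->
  (forall k i, (i <= 2 ^ k)%N -> c <= u (dyadic k i)) ->
  forall r, 0 <= r <= a -> c <= u r.
Proof.
move=> cu cdy r ra; rewrite leNgt; apply/negP => urc.
have itvP q : 0 <= q <= a -> `[0, a]%classic q by rewrite /= in_itv.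
have /subspace_continuousP/(_ r (itvP _ ra)) := cu.
move=> /cvgrPdist_lt/(_ (c - u r)); rewrite subr_gt0 => /(_ urc).
move=> [e /= e0 ue]; have [k [i [ik rki]]] := dyadic_dense ra e0.
have := ue (dyadic k i) rki (itvP _ (dyadic_le ik)).
rewrite distrC => /(le_lt_trans (ler_norm _)).
by rewrite ltrD2r ltNge cdy.
Qed.

End dyadic_grid.

Section strong_continuity.
Context (R : realType) (X : ptopologicalType) (T : R -> (X -> R) -> X -> R).
Hypothesis T_semigroup : C0_contraction_semigroup T.

Lemma le_sup_norm (f : X -> R) x : C0 f -> `|f x| <= sup_norm f.
Proof.
move=> /C0_bounded[M _ fM]; apply: sup_upper_bound; last by exists x.
split; first by exists `|f x|, x.
by exists M => _ [y _ <-].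
Qed.

Lemma sup_norm_le (f : X -> R) c : (forall x, `|f x| <= c) -> sup_norm f <= c.
Proof.
move=> fc; apply: ge_sup => [|_ [x _ <-]//].
by exists `|f point|, point.
Qed.

Lemma C0_sub (f g : X -> R) : C0 f -> C0 g -> C0 (fun x => f x - g x).
Proof.
move=> cf cg; have := C0_axpy (- 1) cg cf.
by under eq_fun do rewrite mulN1r addrC.
Qed.

Lemma semigroup_sub t f g : 0 <= t -> C0 f -> C0 g ->
  T t (fun x => f x - g x) = (fun x => T t f x - T t g x).
Proof.
move=> t0 cf cg; have := C0sg_linear T_semigroup (- 1) t0 cg cf.
under eq_fun do rewrite mulN1r addrC.
by under [RHS]eq_fun do rewrite mulN1r addrC.
Qed.

(** For [p = q + h] the difference is [T_q (T_h F - F)], and [T_q] is a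
    contraction; the bound is therefore uniform in [q] and in the point. *)
Lemma semigroup_equicontinuous (F : X -> R) (e : R) : C0 F -> 0 < e ->
  exists2 eta, 0 < eta & forall p q x, 0 <= p -> 0 <= q -> `|p - q| < eta ->
    `|T p F x - T q F x| <= e.
Proof.
move=> cF e0; have := C0sg_continuous T_semigroup cF.
move=> /cvgrPdist_lt/(_ e e0)[eta /= eta0 H].
have small h x : 0 <= h -> h < eta -> `|T h F x - F x| <= e.
  rewrite le_eqVlt => /predU1P[<- _|h0 he].
    by rewrite (C0sg_0 T_semigroup)// subrr normr0 ltW.
  have := H h; rewrite /= sub0r normrN gtr0_norm// => /(_ he h0).
  rewrite sub0r normrN => /ltW; apply: le_trans.
  apply: le_trans (ler_norm _); apply: (@le_sup_norm (fun x => T h F x - F x)).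
  apply: C0_sub => //; apply: C0sg_C0 T_semigroup _ _ _ cF; exact: ltW.
have main p q x : 0 <= q -> q <= p -> p - q < eta -> `|T p F x - T q F x| <= e.
  move=> q0 qp pq; have h0 : 0 <= p - q by rewrite subr_ge0.
  have cT := C0sg_C0 T_semigroup h0 cF.
  have -> : T p F = T q (T (p - q) F) by rewrite -(C0sg_add T_semigroup)// addrC subrK.
  have -> : T q (T (p - q) F) x - T q F x = T q (fun y => T (p - q) F y - F y) x.
    by rewrite semigroup_sub.
  have cD := C0_sub cT cF.
  apply: le_trans (le_sup_norm _ (C0sg_C0 T_semigroup q0 cD)) _.
  apply: le_trans (C0sg_contraction T_semigroup q0 cD) _.
  by apply: sup_norm_le => y; exact: small.
exists eta => // p q x p0 q0 pq; have [qp|/ltW pq'] := leP q p.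
  by apply: main => //; exact: le_lt_trans (ler_norm _) pq.
rewrite distrC; apply: main => //; rewrite distrC in pq.
exact: le_lt_trans (ler_norm _) pq.
Qed.

End strong_continuity.

Section surviving_paths.
Context (R : realType) (I : set R) (I0 : I !=set0).
Local Notation E := (spacetime I0).
Local Notation Ept := (spacetime_pt I0).
Context (T : R -> (E -> R) -> E -> R) (P : R -> R.-spker E ~> E).
Hypotheses (T_semigroup : C0_contraction_semigroup T) (P_T : represents T P).
Hypothesis P_space_time : is_space_time P.
Context d (Omega : measurableType d).
Variables (Pr : Ept -> probability Omega R) (W : R -> Omega -> Ept).
Hypotheses (W_process : associated_process P Pr W) (W_diffusion : is_diffusion Pr W).
Variable a : R.
Hypothesis a0 : 0 < a.

Let W_markov := process_strong_Markov W_process.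

Definition space_coordinate (w : Ept) : R :=
  extend0 (fun e : time_space I0 => subline_val e.2) w.

Definition time_coordinate (w : Ept) : R :=
  extend0 (fun e : time_space I0 => subline_val e.1) w.

(** The set of states with the wrong time coordinate is open, hence Borel, and the
    space-time property makes it null for [P_r]. *)
Lemma time_marginal (w : E) r : 0 <= r ->
  {ae Pr (Some w), forall o, forall e, W r o = Some e ->
     subline_val e.1 = subline_val w.1 + r}.
Proof.
move=> r0; pose B := [set e : E | subline_val e.1 <> subline_val w.1 + r].
have mB : measurable B by exact: measurable_time_neq.
have mS : measurable [set o | (Some @` B) (W r o)].
  have := csM_measurable W_markov r0.
  by move=> /(_ measurableT _ (measurable_Some mB)); rewrite setTI.
exists [set o | (Some @` B) (W r o)]; split => //; last first.
  move=> o /= /existsNP[e /not_implyP[We eB]]; exists e => //.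
have := simple_markov W_markov (Some w) (lexx 0) r0 (_ : natural_filtration W 0 setT)
  (measurable_Some mB).
rewrite setTI add0r => ->; last first.
  by rewrite -setC0; apply: sigma_algebraC; exact: sigma_algebra0.
rewrite (ae_eq_integral (cst 0%E))//; first exact: integral0.
- under eq_fun do rewrite extended_kernel_Some.
  exact: (measurableT_comp (measurable_alive_kernel P r mB)
    (csM_measurable W_markov (lexx 0))).
- apply: filterS (starts_at W_markov w) => o Wo _.
  by rewrite Wo extended_kernel_Some /= P_space_time.
Qed.

Definition survives (F : E -> R) (w : E) (o : Omega) :=
  W 0 o = Some w /\
  forall r, 0 <= r <= a -> exists e, [/\ W r o = Some e,
    subline_val e.1 = subline_val w.1 + r & 0 < T (a - r) F e].

Definition continuous_path o := {within `[0, a], continuous (fun r => W r o)}.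

(** The cemetery is absorbing. *)
Lemma alive_before o : W a o <> None -> forall r, 0 <= r <= a -> W r o <> None.
Proof.
move=> Wa r /andP[r0 ra] Wr; apply: Wa; apply: (process_absorbed W_process) (ltW a0) _.
apply: (@le_trans _ _ r%:E); last by rewrite lee_fin.
by apply: ereal_inf_lbound; exists r.
Qed.

Lemma lifetime_gt o : W a o <> None -> (a%:E < lifetime W o)%E.
Proof.
move=> Wa; rewrite ltNge; apply/negP => la; apply: Wa.
by apply: (process_absorbed W_process) la; exact: ltW.
Qed.

Lemma extend0_path_continuous (f : time_space I0 -> R) o :
  continuous f -> W a o <> None -> continuous_path o ->
  {within `[0, a], continuous (fun r => extend0 f (W r o))}.
Proof.
move=> cf Wa; apply: within_continuous_comp => _ /set_mem[r /= ra <-].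
rewrite in_itv /= in ra; have := alive_before Wa ra.
by case: (W r o) => // e _; exact/extend0_continuous_at/cf.
Qed.

(** Continuity along the path combines that of [T_(a-r) F] at a fixed time with
    the equicontinuity of the semigroup in time. *)
Lemma value_path_continuous F o : C0 F -> W a o <> None -> continuous_path o ->
  {within `[0, a], continuous (fun r => value T W F a r o)}.
Proof.
move=> cF Wa co; apply/subspace_continuousP => r ra.
have ra' : 0 <= r <= a by move: ra; rewrite /= in_itv.
have ar0 : 0 <= a - r by rewrite subr_ge0; case/andP: ra'.
have cT := C0sg_C0 T_semigroup ar0 cF.
have /subspace_continuousP/(_ r ra) := extend0_path_continuous cT.1 Wa co.
move=> /cvgrPdist_lt cvgr; apply/cvgrPdist_lt => e e0.
have e2 : 0 < e / 2 by rewrite divr_gt0.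
have [eta eta0 Heta] := semigroup_equicontinuous T_semigroup cF e2.
have near_eta : \forall q \near within `[0, a] (nbhs r), `|r - q| < eta.
  by apply: cvg_within; exists eta.
near=> q.
have qa : 0 <= q <= a.
  have : `[0, a]%classic q by near: q; exact: withinT.
  by rewrite /= in_itv.
have rq : `|r - q| < eta by near: q.
rewrite /value.
have -> : extend0 (T (a - r) F) (W r o) - extend0 (T (a - q) F) (W q o) =
  (extend0 (T (a - r) F) (W r o) - extend0 (T (a - r) F) (W q o)) +
  (extend0 (T (a - r) F) (W q o) - extend0 (T (a - q) F) (W q o)) by rewrite subrKA.
rewrite (le_lt_trans (ler_normD _ _))// [ltRHS](splitr e) ltr_leD//.
  by near: q; exact: cvgr.
case: (W q o) => [x|] /=; last by rewrite subrr normr0 ltW.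
apply: Heta => //; first by rewrite subr_ge0; case/andP: qa.
by rewrite opprB addrC subrKA distrC.
Unshelve. all: by end_near. Qed.

(** The events that the martingale exceeds [delta = T_a F w / 2] on the dyadic
    grids decrease, and [grid_bound] keeps their probabilities away from zero, so
    their intersection is charged.  It meets every almost sure event: a path
    starting at [w], continuous during its life and with the right time
    coordinate at dyadic times.  Such a path is alive at time [a], where its value
    is positive, and continuity extends both properties from dyadic times to all
    times; the inequality stays strict because [delta > 0]. *)
Lemma surviving_path (F : E -> R) (w : E) : C0 F -> 0 < T a F w ->
  exists2 o, survives F w o & continuous_path o.
Proof.
move=> cF Fw; have [C C0' FC] := C0_bounded cF.
pose delta := T a F w / 2; have delta0 : 0 < delta by rewrite divr_gt0.
have aw := ltW a0.
pose D k := above T W F a delta (dyadic a k) (2 ^ k).+1.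
have mD k : measurable (D k).
  apply: (natural_filtration_measurable W_markov aw).
  have le_a i : (i < (2 ^ k).+1)%N -> dyadic a k i <= a.
    by rewrite ltnS => /(dyadic_le a0)/andP[].
  exact: (above_filtration T_semigroup delta cF (dyadic_nd a0 k) (dyadic0 a k)
    (dyadic_last a k) (leqnn _) le_a).
have DP k : ((delta / C)%:E <= Pr (Some w) (D k))%E.
  have := grid_bound T_semigroup P_T W_markov w cF aw (dyadic_nd a0 k) (dyadic0 a k)
    (dyadic_last a k) (ltW C0') FC (ltW delta0).
  have -> : T a F w - delta = delta by rewrite /delta {1}(splitr (T a F w)) addrK.
  by rewrite -/(D k) -lee_pdivrMl// -EFinM mulrC.
have D_nd : {homo D : n m / (n <= m)%N >-> (m <= n)%O}.
  apply/nonincreasing_seqP => k; apply/subsetPset => o Dk i ik.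
  rewrite -dyadic_double; apply: Dk.
  by rewrite ltnS expnS -mul2n leq_pmul2l// -ltnS.
have mDI : measurable (\bigcap_k D k) by exact: bigcap_measurable.
have DI : (0 < Pr (Some w) (\bigcap_k D k))%E.
  apply: (@lt_le_trans _ _ (delta / C)%:E); first by rewrite lte_fin divr_gt0.
  have D0 : (Pr (Some w) (D 0%N) < +oo)%E.
    by rewrite (le_lt_trans (probability_le1 _ _)) ?ltry.
  have cv := nonincreasing_cvg_mu D0 mD mDI D_nd.
  rewrite -(cvg_lim (@ereal_hausdorff R) cv); apply: lime_ge; first exact: cvgP cv.
  by apply: nearW => k; exact: DP.
pose G o := [/\ W 0 o = Some w,
  forall k i e, (i <= 2 ^ k)%N -> W (dyadic a k i) o = Some e ->
    subline_val e.1 = subline_val w.1 + dyadic a k i &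
  {within [set t : R | (0 <= t)%R /\ (t%:E < lifetime W o)%E],
      continuous (fun t => W t o)}].
have aeG : {ae Pr (Some w), forall o, G o}.
  have aeT : {ae Pr (Some w), forall o, forall k i e, (i <= 2 ^ k)%N ->
      W (dyadic a k i) o = Some e -> subline_val e.1 = subline_val w.1 + dyadic a k i}.
    apply: ae_foralln => k; apply: ae_foralln => i.
    have [ik|ik] := boolP (i <= 2 ^ k)%N; last by apply: nearW.
    have /andP[r0 _] := dyadic_le a0 ik.
    by apply: filterS (time_marginal w r0) => o Wo e; move=> _; exact: Wo.
  by apply: filterS3 (starts_at W_markov w) aeT (W_diffusion (Some w)).
have [om Do [Wo oT oc]] := exists_of_ae mDI DI aeG.
have dv k i : (i <= 2 ^ k)%N -> delta < value T W F a (dyadic a k i) om.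
  by move=> ik; apply: (Do k).
have Wa : W a om <> None.
  move=> Wa; have := dv 0%N (2 ^ 0)%N (leqnn _).
  by rewrite dyadic_last /value Wa /= ltNge ltW.
have cpath : continuous_path om.
  apply: continuous_subspaceW oc => r; rewrite /= in_itv /= => /andP[r0 ra]; split => //.
  by apply: le_lt_trans (lifetime_gt Wa); rewrite lee_fin.
exists om => //; split => // r ra.
have := alive_before Wa ra; case Wr : (W r om) => [e|//] _; exists e; split => //.
- have ctime := extend0_path_continuous (@time_continuous _ _ I0) Wa cpath.
  have cdiff : {within `[0, a], continuous
      (fun r => time_coordinate (W r om) - (subline_val w.1 + r))}.
    move=> x; apply: cvgB; first exact: ctime.
    by apply: cvgD; [exact: cvg_cst|exact: (@continuous_subspaceT _ _ _ id (fun=> cvg_id))].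
  have z k i : (i <= 2 ^ k)%N ->
      time_coordinate (W (dyadic a k i) om) - (subline_val w.1 + dyadic a k i) = 0.
    move=> ik; have := alive_before Wa (dyadic_le a0 ik).
    by case We : (W _ om) => [e'|//] _; rewrite /time_coordinate /= (oT k i e' ik We) subrr.
  have ge : 0 <= time_coordinate (W r om) - (subline_val w.1 + r).
    by apply: (le_of_le_dyadic a0 cdiff) ra => k i ik; rewrite z.
  have cdiffN : {within `[0, a], continuous
      (fun r => - (time_coordinate (W r om) - (subline_val w.1 + r)))}.
    by move=> x; apply: cvgN; exact: cdiff.
  have le : 0 <= - (time_coordinate (W r om) - (subline_val w.1 + r)).
    apply: (le_of_le_dyadic a0 cdiffN) ra => k i ik.
    by rewrite z// oppr0.
  by move: ge le; rewrite Wr /time_coordinate /=; lra.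
- have cv := value_path_continuous cF Wa cpath.
  have := le_of_le_dyadic a0 cv (fun k i ik => ltW (dv k i ik)) ra.
  by rewrite /value Wr /=; exact: lt_le_trans.
Qed.

End surviving_paths.

(** * The semigroup diminishes the variation of functions *)
Section variation_diminishing_semigroup.
Context (R : realType) (I : set R) (I0 : I !=set0).
Local Notation E := (spacetime I0).
Local Notation Ept := (spacetime_pt I0).
Context (T : R -> (E -> R) -> E -> R) (P : R -> R.-spker E ~> E).
Hypotheses (T_semigroup : C0_contraction_semigroup T) (P_T : represents T P).
Hypothesis P_space_time : is_space_time P.
Context d (Omega : measurableType d).
Variables (Pr : Ept -> probability Omega R) (W : R -> Omega -> Ept).
Hypotheses (W_process : associated_process P Pr W) (W_diffusion : is_diffusion Pr W).

Lemma C0_scale c (F : E -> R) : C0 F -> C0 (fun e => c * F e).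
Proof.
move=> cF; have := C0_axpy c cF (C0_cst0 _ _).
by under eq_fun do rewrite addr0.
Qed.

Lemma semigroup_scale t c (F : E -> R) : 0 <= t -> C0 F ->
  T t (fun e => c * F e) = (fun e => c * T t F e).
Proof.
move=> t0 cF; have c0 := C0_cst0 R E.
have T0 : T t (fun=> 0) = (fun=> 0).
  have := semigroup_sub T_semigroup t0 c0 c0; rewrite subrr => ->.
  by apply/funext => e; rewrite subrr.
have := C0sg_linear T_semigroup c t0 cF c0; rewrite T0.
by under eq_fun do rewrite addr0; under [X in _ = X -> _]eq_fun do rewrite addr0.
Qed.

Variable a : R.
Hypothesis a0 : 0 < a.

(** If the order were reversed at time [a], the space coordinates would agree at
    some time by the intermediate value theorem.  The time coordinates always
    agree, so the paths would meet at a point where both functions are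
    positive. *)
Lemma opposite_paths_ordered (F G : E -> R) (w1 w2 : E) o1 o2 :
  (forall r e, 0 <= r <= a -> ~ (0 < T (a - r) F e /\ 0 < T (a - r) G e)) ->
  subline_val w1.1 = subline_val w2.1 -> subline_val w1.2 < subline_val w2.2 ->
  survives T W a F w1 o1 -> continuous_path W a o1 ->
  survives T W a G w2 o2 -> continuous_path W a o2 ->
  space_coordinate (W a o1) < space_coordinate (W a o2).
Proof.
move=> FG w12 x12 [W1 s1] c1 [W2 s2] c2.
have aa : 0 <= a <= a by rewrite (ltW a0) lexx.
have alive (F' : E -> R) (w : E) o : (forall r, 0 <= r <= a -> exists e, [/\ W r o = Some e,
    subline_val e.1 = subline_val w.1 + r & 0 < T (a - r) F' e]) -> W a o <> None.
  by move=> /(_ a aa)[e [-> _ _]].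
pose g r := space_coordinate (W r o2) - space_coordinate (W r o1).
have cg : {within `[0, a], continuous g}.
  have ext := extend0_path_continuous W_process a0 (@space_continuous _ _ I0).
  have ext1 := ext _ (alive F w1 o1 s1) c1; have ext2 := ext _ (alive G w2 o2 s2) c2.
  by move=> x; apply: cvgB; [exact: ext2|exact: ext1].
rewrite -subr_gt0 -/(g a) ltNge; apply/negP => ga.
have g0 : 0 < g 0 by rewrite /g W1 W2 /space_coordinate /= subr_gt0.
have [|c] := IVT (ltW a0) cg (v := 0).
  by rewrite ge_min ga orbT le_max (ltW g0).
rewrite in_itv /= => ca /eqP; rewrite subr_eq0 => /eqP.
have [e1 [We1 t1 F1]] := s1 c ca; have [e2 [We2 t2 G2]] := s2 c ca.
rewrite We1 We2 /space_coordinate /= => x21; apply: (FG c e1 ca); split => //.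
suff -> : e1 = e2 by [].
case: e1 e2 t1 t2 x21 {F1 G2 We1 We2} => [p1 q1] [p2 q2] /= t1 t2 /subline_val_inj ->.
by congr (_, _); apply: subline_val_inj; rewrite t1 t2 w12.
Qed.

(** Consecutive points carry opposite signs, so their surviving paths stay
    ordered; the end points of these paths are the points [z]. *)
Lemma semigroup_variation_diminishing (F : E -> R) (s0 t0 : half_line R) m
    (y : 'I_m -> subline I0) : C0 F -> subline_val t0 = subline_val s0 + a ->
  (forall i j : 'I_m, (i < j)%N -> subline_val (y i) < subline_val (y j)) ->
  (forall i : 'I_m, 0 < (-1) ^+ i * T a F (s0, y i)) ->
  exists z : 'I_m -> subline I0,
    (forall i j : 'I_m, (i < j)%N -> subline_val (z i) < subline_val (z j)) /\
    (forall i : 'I_m, 0 < (-1) ^+ i * F (t0, z i)).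
Proof.
move=> cF st yy yF; have aa : 0 <= a <= a by rewrite (ltW a0) lexx.
pose Fi (i : 'I_m) (e : E) := (-1) ^+ i * F e.
have cFi i : C0 (Fi i) by exact: C0_scale.
have TFi r i : 0 <= r <= a -> T (a - r) (Fi i) = (fun e => (-1) ^+ i * T (a - r) F e).
  by move=> /andP[_ ra]; apply: semigroup_scale => //; rewrite subr_ge0.
have path i : exists oe : Omega * E, [/\ survives T W a (Fi i) (s0, y i) oe.1,
    continuous_path W a oe.1, W a oe.1 = Some oe.2, oe.2.1 = t0 & 0 < Fi i oe.2].
  have [|om som com] := surviving_path T_semigroup P_T P_space_time W_process W_diffusion
    a0 (w := (s0, y i)) (cFi i).
    by have := TFi 0 i; rewrite subr0 lexx (ltW a0) => ->.
  have [_ /(_ a aa)[e [We te]]] := som; rewrite subrr (C0sg_0 T_semigroup)// => Fe.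
  by exists (om, e); split => //; apply: subline_val_inj; rewrite te st.
have {path}[f fP] := choice path.
pose z i := (f i).2.2.
have fz i : (f i).2 = (t0, z i).
  by have [_ _ _ ft _] := fP i; rewrite /z -ft; case: (f i).2.
exists z; split; last by move=> i; have [_ _ _ _] := fP i; rewrite fz.
have step (i j : 'I_m) : (i.+1 = j :> nat) -> subline_val (z i) < subline_val (z j).
  move=> ij; have [si ci Wi _ _] := fP i; have [sj cj Wj _ _] := fP j.
  have := opposite_paths_ordered _ (erefl : subline_val (s0, y i).1 = subline_val (s0, y j).1)
    _ si ci sj cj.
  rewrite Wi Wj !fz /space_coordinate /=; apply; last by apply: yy; rewrite -ij.
  move=> r e ra; rewrite !TFi// -ij exprS mulN1r mulNr oppr_gt0 => -[].
  by move=> /ltW /le_lt_trans/[apply]; rewrite ltxx.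
move=> i [j jm] /= ij.
elim: j jm ij => // j IH jm; rewrite ltnS leq_eqVlt => /predU1P[ij|ij].
  by apply: step; rewrite /= ij.
have jm' := ltnW jm.
by apply: lt_trans (IH jm' ij) _; exact: step.
Qed.

End variation_diminishing_semigroup.

(** * Alternating products as iterated integrals *)
Section positivity.
Context d (X : measurableType d) (R : realType).
Implicit Type m : {measure set X -> \bar R}.
Local Open Scope ereal_scope.

Lemma measure_bigcup_gt0 m (F : nat -> set X) : (forall k, measurable (F k)) ->
  0 < m (\bigcup_k F k) -> exists k, 0 < m (F k).
Proof.
move=> mF; apply: contraPP => /forallNP F0; apply/negP; rewrite -leNgt.
rewrite measure_negligible//; first exact: bigcup_measurable.
apply: negligible_bigcup => k; apply/negligibleP => //.
by apply/eqP; rewrite eq_le measure_ge0 andbT leNgt; exact/negP/F0.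
Qed.

Lemma measure_bigcup_countable_gt0 (C : countType) m (F : C -> set X) :
  (forall r, measurable (F r)) -> 0 < m (\bigcup_r F r) -> exists r, 0 < m (F r).
Proof.
move=> mF; pose G k := if unpickle k is Some r then F r else set0.
have -> : \bigcup_r F r = \bigcup_k G k.
  apply/seteqP; split => [x [r _ Fx]|x [k _]].
    by exists (pickle r) => //; rewrite /G pickleK.
  by rewrite /G; case: unpickle => // r Fx; exists r.
have mG k : measurable (G k) by rewrite /G; case: unpickle.
move=> /(measure_bigcup_gt0 mG)[k]; rewrite /G.
by case: unpickle => [r ?|]; [exists r|rewrite measure0 ltxx].
Qed.

Lemma measure_gt0U m A B : measurable A -> measurable B ->
  0 < m (A `|` B) -> m A = 0 -> 0 < m B.
Proof.
move=> mA mB AB A0; rewrite ltNge; apply/negP => B0; move: AB.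
rewrite ltNge => /negP; apply; apply: (@le_trans _ _ (m A + m B)).
  exact: measureU2.
by rewrite A0 add0e.
Qed.

Lemma measure_eq0S m A B : measurable A -> measurable B -> A `<=` B ->
  m B = 0 -> m A = 0.
Proof.
move=> mA mB AB B0; apply/eqP; rewrite eq_le measure_ge0 andbT -B0.
by rewrite le_measure ?inE.
Qed.

Lemma measure_gt0S m A B : measurable A -> measurable B -> A `<=` B ->
  0 < m A -> 0 < m B.
Proof. by move=> mA mB AB /lt_le_trans; apply; rewrite le_measure ?inE. Qed.

Lemma integral_gt0P m D (f : X -> \bar R) : measurable D ->
  measurable_fun [set: X] f -> (forall x, 0 <= f x) ->
  (0 < \int[m]_(x in D) f x) <-> (0 < m (D `&` [set x | 0 < f x])).
Proof.
move=> mD mf f0.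
have mS : measurable (D `&` [set x | 0 < f x]).
  apply: measurableI => //; rewrite -[X in measurable X]setTI.
  exact: emeasurable_fun_o_infty.
have eq0 : \int[m]_(x in D) f x = 0 <-> m (D `&` [set x | 0 < f x]) = 0.
  have -> : \int[m]_(x in D) f x = \int[m]_(x in D) `|f x|.
    by apply: eq_integral => x _; rewrite gee0_abs.
  rewrite (ae_eq_integral_abs _ mD); last exact: measurable_funTS.
  split=> [[N [mN N0 DN]]|S0].
    apply: (measure_eq0S mS mN _ N0) => x [Dx /= fx]; apply: DN => /=.
    by move=> /(_ Dx) fx0; move: fx; rewrite fx0 ltxx.
  exists (D `&` [set x | 0 < f x]); split => // x /= /not_implyP[Dx /eqP fx]; split => //=.
  by rewrite lt_def fx f0.
have i0 : 0 <= \int[m]_(x in D) f x by exact: integral_ge0.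
split; rewrite !lt_def ?i0 ?measure_ge0 !andbT => /eqP n0; apply/eqP => e0; apply: n0;
  exact/eq0.
Qed.

End positivity.

Section upsets.
Context (R : realType) (I : set R) (I0 : I !=set0).
Local Notation J := (borel (subline I0)).
Local Notation pos := (@subline_val R I I0).
Implicit Types (U V : set J) (m : {measure set J -> \bar R}).
Local Open Scope ereal_scope.

(** Up-sets rather than half-lines cut the interval: they include its closed and
    its open final pieces, and no end point has to be named. *)
Definition upset U := forall x y, U x -> (pos x <= pos y)%R -> U y.

Lemma measurable_subline_val : measurable_fun [set: J] (pos).
Proof. by apply: continuous_measurable_real; exact: subline_val_continuous. Qed.

Lemma upset_measurable U : upset U -> measurable U.
Proof.
move=> upU; pose D := [set r : R | exists2 x, U x & (pos x <= r)%R].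
have mD : measurable D.
  apply: is_interval_measurable => r s [x Ux xr] [y Uy ys] t /andP[rt _].
  by exists x => //; exact: le_trans rt.
have -> : U = pos @^-1` D.
  apply/seteqP; split => [x Ux|x [y Uy yx]]; first by exists x.
  exact: upU yx.
by rewrite -[X in measurable X]setTI; exact: measurable_subline_val.
Qed.

Lemma downset_measurable (D : set J) : (forall x y, D y -> (pos x <= pos y)%R -> D x) ->
  measurable D.
Proof.
move=> dD; rewrite -[D]setCK; apply: measurableC; apply: upset_measurable.
by move=> x y nDx xy Dy; apply: nDx; exact: dD xy.
Qed.

Lemma antitone_measurable (f : J -> \bar R) :
  (forall x y, (pos x <= pos y)%R -> f y <= f x) ->
  measurable_fun [set: J] f.
Proof.
move=> fanti; apply: (measurability _ (ErealGenOInfty.measurableE R)).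
move=> _ [_ [r ->] <-]; rewrite setTI; apply: downset_measurable => x y /=.
by rewrite !in_itv /= !andbT => fy /fanti; exact: lt_le_trans.
Qed.

Definition ray (q : R) : set J := [set x | (q < pos x)%R].

Lemma upset_ray q : upset (ray q).
Proof. by move=> x y /lt_le_trans; apply. Qed.

Lemma measurable_ray q : measurable (ray q).
Proof. by apply: upset_measurable; exact: upset_ray. Qed.

Lemma upset_setT : upset setT. Proof. by []. Qed.

Lemma upsetU U V : upset U -> upset V -> upset (U `|` V).
Proof. by move=> upU upV x y [/upU Ux|/upV Vx] xy; [left; exact: Ux|right; exact: Vx]. Qed.

Lemma upsetI U V : upset U -> upset V -> upset (U `&` V).
Proof. by move=> upU upV x y [/upU Ux /upV Vx] xy; split; [exact: Ux|exact: Vx]. Qed.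

Lemma upset_lt U x y : upset U -> ~ U x -> U y -> (pos x < pos y)%R.
Proof. by move=> upU nUx Uy; rewrite ltNge; apply/negP => /(upU _ _ Uy). Qed.

Definition increasing_tuples_in U n : set (n.-tuple J) :=
  [set x | increasing_tuples x /\ forall i, U (tnth x i)].

Definition increasing_mass m1 m2 n U :=
  alternating_product m1 m2 (increasing_tuples_in U (n:=n)).

Lemma alternating_product_set0 m1 m2 n : alternating_product m1 m2 (set0 : set (n.-tuple J)) = 0.
Proof.
elim: n m1 m2 => [|n IH] m1 m2 /=; first exact: measure0.
rewrite /pushforward preimage_set0 /product_measure1 /=.
by apply: integral0_eq => x _ /=; rewrite xsection0 IH.
Qed.

Lemma increasing_mass0 m1 m2 U : increasing_mass m1 m2 0 U = 1.
Proof.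
rewrite /increasing_mass /= diracE mem_set//.
by split => [|i] ; [move=> i|]; case: i.
Qed.

(** Once the first entry [x] is chosen, the others form an increasing tuple beyond
    [x].  Iterating this, only integrals of monotone functions on the interval
    occur, and these functions are Borel. *)
Lemma increasing_massS m1 m2 n U : (forall x, U x -> ray (pos x) `<=` U) ->
  increasing_mass m1 m2 n.+1 U =
  \int[m1]_(x in U) increasing_mass m2 m1 n (ray (pos x)).
Proof.
move=> rU; rewrite /increasing_mass /= /pushforward /product_measure1.
rewrite [RHS]integral_mkcond; apply: eq_integral => x _ /=; rewrite /patch.
have [/set_mem Ux|nUx] := boolP (x \in U); last first.
  rewrite (_ : xsection _ _ = set0) ?alternating_product_set0//.
  apply/seteqP; split => // y; rewrite /xsection /= inE /= => -[_ /(_ ord0)].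
  by rewrite tnth0 => Ux; move: nUx; rewrite mem_set.
congr alternating_product; apply/seteqP; split => y; rewrite /xsection /= inE /=.
  move=> [inc Uy]; split => [i j ij|i].
    by have := inc (lift ord0 i) (lift ord0 j); rewrite !tnthS; apply.
  by have := inc ord0 (lift ord0 i) isT; rewrite tnth0 tnthS.
move=> [inc ry]; split => [i j|i].
  case: (unliftP ord0 i) => [i'|] ->; case: (unliftP ord0 j) => [j'|] ->//.
    by rewrite !tnthS => ij; exact: inc.
  by rewrite tnth0 tnthS => _; exact: ry.
by case: (unliftP ord0 i) => [i'|] ->; rewrite ?tnth0// tnthS; exact/(rU x)/ry.
Qed.

Lemma ray_sub U x : upset U -> U x -> ray (pos x) `<=` U.
Proof. by move=> upU Ux y /= /ltW; exact: upU. Qed.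

Lemma alternating_product_ge0 m1 m2 n (A : set (n.-tuple J)) :
  0 <= alternating_product m1 m2 A.
Proof.
elim: n m1 m2 A => [|n IH] m1 m2 A /=; first exact: measure_ge0.
by apply: integral_ge0 => x _ /=; exact: IH.
Qed.

Lemma increasing_mass_antitone m1 m2 n q r : (q <= r)%R ->
  increasing_mass m1 m2 n (ray r) <= increasing_mass m1 m2 n (ray q).
Proof.
elim: n m1 m2 q r => [|n IH] m1 m2 q r qr; first by rewrite !increasing_mass0.
rewrite !increasing_massS; try by move=> x; exact: ray_sub (@upset_ray _).
apply: ge0_subset_integral.
- exact: measurable_ray.
- exact: measurable_ray.
- by apply: measurable_funTS; apply: antitone_measurable => x y; exact: IH.
- by move=> x _; exact: alternating_product_ge0.
- by move=> x /=; exact: le_lt_trans.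
Qed.

Lemma measurable_increasing_mass m1 m2 n :
  measurable_fun [set: J] (fun x => increasing_mass m1 m2 n (ray (pos x))).
Proof. by apply: antitone_measurable => x y; exact: increasing_mass_antitone. Qed.

Lemma increasing_massS_gt0 m1 m2 n U : upset U ->
  (0 < increasing_mass m1 m2 n.+1 U) <->
  (0 < m1 (U `&` [set x | 0 < increasing_mass m2 m1 n (ray (pos x))])).
Proof.
move=> upU; rewrite increasing_massS; last by move=> x; exact: ray_sub.
apply: integral_gt0P; first exact: upset_measurable.
- exact: measurable_increasing_mass.
- by move=> x; exact: alternating_product_ge0.
Qed.

(** Cutting by up-sets alone keeps the charged pieces in order and Borel. *)
Fixpoint alternation m1 m2 n U : Prop :=
  if n is n'.+1 then
    exists U', [/\ upset U', U' `<=` U, 0 < m1 (U `\` U') & alternation m2 m1 n' U']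
  else True.

Lemma alternation_increasing_mass m1 m2 n U V : upset U -> upset V -> V `<=` U ->
  alternation m1 m2 n V -> 0 < increasing_mass m1 m2 n U.
Proof.
elim: n m1 m2 U V => [|n IH] m1 m2 U V upU upV VU; first by rewrite increasing_mass0.
move=> [V' [upV' V'V mV altV']]; apply/increasing_massS_gt0 => //.
have mpos : measurable ([set x | 0 < increasing_mass m2 m1 n (ray (pos x))] : set J).
  rewrite -[X in measurable X]setTI.
  exact: emeasurable_fun_o_infty measurableT (@measurable_increasing_mass m2 m1 n) _.
apply: measure_gt0S mV.
- by apply: measurableD; exact: upset_measurable.
- by apply: measurableI => //; exact: upset_measurable.
- move=> x [Vx nV'x]; split; first exact: VU.
  apply: (IH m2 m1 _ V') => //; first exact: upset_ray.
  by move=> y V'y; exact: upset_lt V'y.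
Qed.

(** Here the charged pieces are open intervals separated by real numbers, so that
    continuous test functions fit inside them. *)
Fixpoint separated_alternation m1 m2 n (q : R) : Prop :=
  if n is n'.+1 then
    exists q', [/\ (q < q')%R, 0 < m1 (ray q `\` [set x | (q' <= pos x)%R]) &
      separated_alternation m2 m1 n' q']
  else True.

Lemma ray_exhaustion (F : nat -> R) U S m : upset U -> measurable S ->
  U = \bigcup_k ray (F k) -> 0 < m (U `&` S) -> exists k, 0 < m (ray (F k) `&` S).
Proof.
move=> upU mS UF; rewrite UF setI_bigcupl => /measure_bigcup_gt0[k|k]; last by exists k.
by apply: measurableI => //; exact: measurable_ray.
Qed.

Lemma rayE q : ray q = \bigcup_k ray (q + k.+1%:R^-1).
Proof.
apply/seteqP; split => [x qx|x [k _]]; last first.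
  by apply: lt_trans; rewrite ltrDl invr_gt0.
have [k kx] : exists k, (k.+1%:R^-1 < pos x - q)%R.
  have x0 : (0 < pos x - q)%R by rewrite subr_gt0.
  exists (Num.truncn (pos x - q)^-1).
  by rewrite invf_plt ?posrE// truncnS_gt.
by exists k => //; rewrite /ray /= addrC -ltrBrDr.
Qed.

Lemma setT_ray : [set: J] = \bigcup_k ray (- k%:R).
Proof.
apply/seteqP; split => // x _; exists (Num.truncn (- pos x)).+1 => //.
by rewrite /ray /= ltrNl; exact: truncnS_gt.
Qed.

(** A first entry [x] beyond which the remaining product has positive mass admits a
    rational [r > x] with the same property, because that mass is continuous
    from the right in the sense of [rayE].  The countably many intervals from [q]
    to such rationals cover all these [x], so [m1] charges one of them. *)
Lemma increasing_mass_separated m1 m2 n q : 0 < increasing_mass m1 m2 n (ray q) ->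
  separated_alternation m1 m2 n q.
Proof.
have mpos k l p : measurable ([set x | 0 < increasing_mass k l p (ray (pos x))] : set J).
  rewrite -[X in measurable X]setTI.
  exact: emeasurable_fun_o_infty measurableT (@measurable_increasing_mass k l p) _.
elim: n m1 m2 q => // n IH m1 m2 q /increasing_massS_gt0 -/(_ (@upset_ray q)) mq.
pose F r := if (q < ratr r)%R && (0 < increasing_mass m2 m1 n (ray (ratr r)))
  then ray q `\` [set x | (ratr r <= pos x)%R] else set0.
have mge r : measurable [set x : J | (r <= pos x)%R].
  by apply: upset_measurable => x y /le_trans; apply.
have mF r : measurable (F r).
  rewrite /F; case: ifP => // _; apply: measurableD => //.
  exact: measurable_ray.
have [r] : exists r : rat, 0 < m1 (F r).
  apply: measure_bigcup_countable_gt0 => //; apply: measure_gt0S mq.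
  - by apply: measurableI => //; exact: measurable_ray.
  - exact: countable_bigcupT_measurable.
  move=> x [qx /= hx].
  have [q' xq' hq'] : exists2 q', (pos x < q')%R & 0 < increasing_mass m2 m1 n (ray q').
    case: n hx {IH F mF} => [|n]; first by exists (pos x + 1)%R;
      rewrite ?ltrDl// increasing_mass0.
    move=> /increasing_massS_gt0 -/(_ (@upset_ray _)).
    move=> /(ray_exhaustion (@upset_ray _) (mpos _ _ _) (rayE _))[k hk].
    exists (pos x + k.+1%:R^-1)%R; first by rewrite ltrDl invr_gt0.
    by apply/increasing_massS_gt0; first exact: upset_ray.
  have [r] := rat_in_itvoo xq'; rewrite in_itv /= => /andP[xr rq'].
  exists r => //; rewrite /F (lt_trans qx xr) /= ifT; last first.
    by apply: lt_le_trans hq' _; apply: increasing_mass_antitone; exact: ltW.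
  by split => //= rx; move: xr; rewrite ltNge rx.
rewrite /F; case: ifP; last by rewrite measure0 ltxx.
move=> /andP[qr hr] mr; exists (ratr r); split => //.
exact: IH.
Qed.

Lemma alternation_of_mass m1 m2 n :
  0 < alternating_product m1 m2 (@increasing_tuples _ _ I0 n) ->
  exists q, separated_alternation m1 m2 n q.
Proof.
have -> : @increasing_tuples _ _ I0 n = increasing_tuples_in setT (n := n).
  by apply/seteqP; split => [x|x []].
case: n => [|n] H; first by exists 0%R.
have : 0 < increasing_mass m1 m2 n.+1 setT by [].
move=> /increasing_massS_gt0 -/(_ upset_setT).
have mpos : measurable ([set x | 0 < increasing_mass m2 m1 n (ray (pos x))] : set J).
  rewrite -[X in measurable X]setTI.
  exact: emeasurable_fun_o_infty measurableT (@measurable_increasing_mass m2 m1 n) _.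
move=> /(ray_exhaustion upset_setT mpos setT_ray)[k hk].
exists (- k%:R)%R; apply: increasing_mass_separated.
by apply/increasing_massS_gt0 => //; exact: upset_ray.
Qed.

Lemma mass_of_alternation m1 m2 n : alternation m1 m2 n setT ->
  0 < alternating_product m1 m2 (@increasing_tuples _ _ I0 n).
Proof.
move=> altT; have -> : @increasing_tuples _ _ I0 n = increasing_tuples_in setT (n := n).
  by apply/seteqP; split => [x|x []].
exact: (alternation_increasing_mass upset_setT upset_setT (@subset_refl _ _) altT).
Qed.

End upsets.

(** * Blocks of constant sign *)
Section sign_blocks.
Context (R : realType) (I : set R) (I0 : I !=set0).
Local Notation J := (borel (subline I0)).
Local Notation pos := (@subline_val R I I0).
Implicit Types (U V : set J) (m : {measure set J -> \bar R}).
Local Open Scope ereal_scope.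

Definition singular m1 m2 := exists2 S : set J, measurable S & m1 S = 0 /\ m2 (~` S) = 0.

Lemma singular_sym m1 m2 : singular m1 m2 -> singular m2 m1.
Proof.
by move=> [S mS [S1 S2]]; exists (~` S); rewrite ?setCK//; exact: measurableC.
Qed.

Lemma upsetD_measurable U V : upset U -> upset V -> measurable (U `\` V).
Proof. by move=> upU upV; apply: measurableD; exact: upset_measurable. Qed.

Lemma measurable_point (x : J) : measurable [set x].
Proof.
have -> : [set x] = pos @^-1` [set pos x].
  by apply/seteqP; split => [y ->//|y /= /subline_val_inj].
by rewrite -[X in measurable X]setTI; exact: measurable_subline_val.
Qed.

(** The first block consists of the points of [U] up to which [m1] has no mass.  It
    is [m1]-null, and [m1] charges every initial piece of the remainder [V] that
    contains a point of [V].  An alternation of [V] beginning with [m2] can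
    therefore be preceded by a piece charged by [m1], provided some initial point
    of [V] is given up without losing the [m2]-mass of its first piece.  If [V]
    has a least point, then [m1] charges it, hence [m2] does not; otherwise
    countably many final pieces of [V] exhaust it. *)
Lemma first_block m1 m2 U : singular m1 m2 -> upset U ->
  exists V, [/\ upset V, V `<=` U, m1 (U `\` V) = 0 &
    forall n, ~ alternation m1 m2 n.+2 U -> ~ alternation m2 m1 n.+1 V].
Proof.
move=> [S mS [S1 S2]] upU.
pose low (r : R) : set J := U `\` ray r.
have mlow r : measurable (low r) by apply: upsetD_measurable => //; exact: upset_ray.
have low_le r s : (r <= s)%R -> low r `<=` low s.
  by move=> rs x [Ux /= /negP]; rewrite -leNgt => xr; split => //=; apply/negP;
     rewrite -leNgt (le_trans xr).
pose V : set J := [set x | U x /\ 0 < m1 (low (pos x))].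
have upV : upset V.
  move=> x y [Ux x0] xy; split; first exact: upU xy.
  by apply: measure_gt0S x0 => //; exact: low_le.
have VU : V `<=` U by move=> x [].
have nV x : U x -> ~ V x -> m1 (low (pos x)) = 0.
  move=> Ux nVx; apply/eqP; rewrite eq_le measure_ge0 andbT leNgt; apply/negP => x0.
  exact: nVx.
have mUV := upsetD_measurable upU upV.
have UV0 : m1 (U `\` V) = 0.
  have [[x [[Ux nVx] xmax]]|nomax] := pselect (exists x, (U `\` V) x /\
      forall y, (U `\` V) y -> (pos y <= pos x)%R).
    apply: (measure_eq0S mUV (mlow (pos x)) _ (nV x Ux nVx)) => y UVy.
    by split; [exact: UVy.1|rewrite /ray /=; apply/negP; rewrite -leNgt xmax].
  apply/eqP; rewrite eq_le measure_ge0 andbT leNgt; apply/negP => UV0.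
  pose F (r : rat) := if m1 (low (ratr r)) == 0 then low (ratr r) else set0.
  have [r] : exists r : rat, 0 < m1 (F r).
    apply: measure_bigcup_countable_gt0; first by move=> r; rewrite /F; case: ifP.
    apply: measure_gt0S UV0 => //.
      by apply: countable_bigcupT_measurable => // r; rewrite /F; case: ifP.
    move=> x UVx; have [y UVy xy] : exists2 y, (U `\` V) y & (pos x < pos y)%R.
      apply: contrapT => noy; apply: nomax; exists x; split => // y UVy.
      by rewrite leNgt; apply/negP => xy; apply: noy; exists y.
    have [r] := rat_in_itvoo xy; rewrite in_itv /= => /andP[xr ry].
    exists r => //; rewrite /F ifT; last first.
      by apply/eqP; apply: (measure_eq0S _ _ (low_le _ _ (ltW ry)) (nV y UVy.1 UVy.2)).
    by split; [exact: UVx.1|rewrite /ray /=; apply/negP; rewrite -leNgt ltW].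
  by rewrite /F; case: ifP => [/eqP ->|_]; rewrite ?measure0 ltxx.
exists V; split => // n; apply: contra_not => -[V' [upV' V'V mV' altV']].
suff [V'' [upV'' V''V V'V'' [x Vx nV''x] mV'']] : exists V'', [/\ upset V'', V'' `<=` V,
    V' `<=` V'', exists2 x, V x & ~ V'' x & 0 < m2 (V'' `\` V')].
  exists V''; split => //; first exact: subset_trans VU.
    apply: measure_gt0S Vx.2 => //; first exact: upsetD_measurable.
    move=> y [Uy /= /negP]; rewrite -leNgt => yx; split => // V''y.
    by apply: nV''x; exact: upV'' V''y yx.
  by exists V'; split.
pose F (r : rat) := (V `&` ray (ratr r)) `\` V'.
have upVr r : upset (V `&` ray r) by apply: upsetI => //; exact: upset_ray.
have [[x [Vx xmin]]|nomin] := pselect (exists x, V x /\ forall y, V y -> (pos x <= pos y)%R).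
  exists (V `&` ray (pos x)); split => //.
  - move=> y V'y; split; first exact: V'V.
    rewrite /ray /= lt_neqAle xmin ?andbT; last exact: V'V.
    apply/eqP => /subline_val_inj xy; move: mV'; rewrite (_ : V `\` V' = set0) ?measure0 ?ltxx//.
    apply/seteqP; split => // z [Vz]; apply; rewrite -xy in V'y.
    by apply: upV' V'y _; exact: xmin.
  - by exists x => // -[_]; rewrite /ray /= ltxx.
  have mx : m2 [set x] = 0.
    have m1x : 0 < m1 [set x].
      apply: (@measure_gt0U _ _ _ m1 (U `\` V)) => //; first exact: measurable_point.
      apply: measure_gt0S Vx.2 => //; first by apply: measurableU => //; exact: measurable_point.
      move=> y [Uy /= /negP]; rewrite -leNgt => yx.
      have [Vy|nVy] := pselect (V y); [right|by left].
      by apply: subline_val_inj; apply/eqP; rewrite eq_le yx xmin.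
    have nSx : ~ S x.
      move=> Sx; move: m1x; rewrite (measure_eq0S _ mS _ S1) ?ltxx//.
        exact: measurable_point.
      by move=> _ ->.
    apply: (measure_eq0S _ _ _ S2); [exact: measurable_point|exact: measurableC|].
    by move=> _ ->.
  apply: (@measure_gt0U _ _ _ m2 [set x]) => //.
  - exact: measurable_point.
  - by apply: upsetD_measurable.
  - apply: measure_gt0S mV'; first exact: upsetD_measurable.
      by apply: measurableU; [exact: measurable_point|exact: upsetD_measurable].
    move=> y [Vy nV'y]; have := xmin y Vy; rewrite le_eqVlt => /predU1P[xy|xy].
      by left; apply: subline_val_inj.
    by right.
have [r [mr [x Vx xr]]] : exists r : rat, 0 < m2 (F r) /\ exists2 x, V x & (pos x < ratr r)%R.
  pose G r := if `[< exists2 x, V x & (pos x < ratr r)%R >] then F r else set0.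
  have [r] : exists r, 0 < m2 (G r).
    have mG r : measurable (G r) by rewrite /G; case: ifP => // _; exact: upsetD_measurable.
    apply: measure_bigcup_countable_gt0 => //.
    apply: measure_gt0S mV'; first exact: upsetD_measurable.
      exact: countable_bigcupT_measurable.
    move=> y [Vy nV'y]; have [x Vx xy] : exists2 x, V x & (pos x < pos y)%R.
      apply: contrapT => nox; apply: nomin; exists y; split => // x Vx.
      by rewrite leNgt; apply/negP => xy; apply: nox; exists x.
    have [r] := rat_in_itvoo xy; rewrite in_itv /= => /andP[xr ry].
    by exists r => //; rewrite /G asboolT//; exists x.
  by rewrite /G; case: asboolP => [ex mr|_]; [exists r|rewrite measure0 ltxx].
exists (V' `|` (V `&` ray (ratr r))); split.
- exact: upsetU.
- by rewrite subUset; split => // y [].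
- exact: subsetUl.
- exists x => // -[V'x|[_ /=]]; last by rewrite /ray /= ltNge ltW.
  move: mr; rewrite (_ : F r = set0) ?measure0 ?ltxx//.
  apply/seteqP; split => // y [[Vy /= ry]]; apply; apply: upV' V'x _.
  exact/ltW/(lt_trans xr).
- apply: measure_gt0S mr; [exact: upsetD_measurable|apply: upsetD_measurable => //; exact: upsetU|].
  by move=> y [Vry nV'y]; split => //; right.
Qed.

(** A block may be null for both measures, so [k] bounds the number of sign blocks
    rather than counting them. *)
Fixpoint sign_blocks m1 m2 k U : Prop :=
  if k is k'.+1 then
    exists V, [/\ upset V, V `<=` U, m1 (U `\` V) = 0 \/ m2 (U `\` V) = 0 &
      sign_blocks m1 m2 k' V]
  else m1 U = 0 /\ m2 U = 0.

Lemma sign_blocks_sym m1 m2 k U : sign_blocks m1 m2 k U -> sign_blocks m2 m1 k U.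
Proof.
elim: k U => [|k IH] U; first by case.
by move=> [V [upV VU UV /IH bV]]; exists V; split => //; case: UV; [right|left].
Qed.

Lemma sign_blocks_null m1 m2 k U V : upset U -> upset V -> V `<=` U ->
  m1 (U `\` V) = 0 -> m2 (U `\` V) = 0 -> sign_blocks m1 m2 k V -> sign_blocks m1 m2 k U.
Proof.
move=> upU upV VU m1UV m2UV.
have ext m V' : upset V' -> V' `<=` V -> m (U `\` V) = 0 -> m (V `\` V') = 0 ->
    m (U `\` V') = 0.
  move=> upV' V'V mUV mVV'; apply/eqP; rewrite eq_le measure_ge0 andbT leNgt; apply/negP => UV'.
  have := @measure_gt0U _ _ _ m (U `\` V) (V `\` V').
  rewrite mVV' ltxx => H; suff : false by []; apply: H => //; try exact: upsetD_measurable.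
  apply: measure_gt0S UV'; first exact: upsetD_measurable.
    by apply: measurableU; exact: upsetD_measurable.
  move=> x [Ux nV'x]; have [Vx|nVx] := pselect (V x); [by right|by left].
case: k => [|k] /=.
  rewrite -[X in _ X = 0 /\ _]setD0 -[X in _ /\ _ X = 0]setD0 => -[V1 V2].
  by split; rewrite -[U]setD0; apply: ext.
move=> [V' [upV' V'V VV' bV']]; exists V'; split => //; first exact: subset_trans VU.
by case: VV' => H; [left|right]; apply: ext.
Qed.

(** Excluding only the alternations that begin with [m1] leaves one block more
    than excluding both kinds, as the first block may be charged by [m2]. *)
Lemma one_sided_blocks m1 m2 n U : singular m1 m2 -> upset U ->
  ~ alternation m1 m2 n U -> sign_blocks m1 m2 n U.
Proof.
elim: n m1 m2 U => [|n IH] m1 m2 U sm upU; first by move=> /(_ Logic.I).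
case: n IH => [|n] IH nalt.
  exists set0; rewrite setD0; split => //=.
  left; apply/eqP; rewrite eq_le measure_ge0 andbT leNgt; apply/negP => mU.
  by apply: nalt; exists set0; split => //; rewrite setD0.
have [V [upV VU mUV altV]] := first_block sm upU.
exists V; split => //; first by left.
apply: sign_blocks_sym; apply: IH => //; first exact: singular_sym.
exact: altV.
Qed.

(** If [m2] charges the first block, both kinds of alternations of the remainder
    are shorter by one.  If it does not, that block is null for both measures and
    is merged into the next one, so the one-sided count is enough. *)
Lemma two_sided_blocks m1 m2 n U : singular m1 m2 -> upset U ->
  ~ alternation m1 m2 n.+1 U -> ~ alternation m2 m1 n.+1 U -> sign_blocks m1 m2 n U.
Proof.
elim: n U => [|n IH] U sm upU nalt1 nalt2.
  have null m m' : ~ alternation m m' 1 U -> m U = 0.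
    move=> nalt; apply/eqP; rewrite eq_le measure_ge0 andbT leNgt; apply/negP => mU.
    by apply: nalt; exists set0; split => //; rewrite setD0.
  by split; [exact: null nalt1|exact: null nalt2].
have [V [upV VU mUV altV]] := first_block sm upU.
have naltV := altV n nalt1.
have [m2UV|m2UV] := ltP 0 (m2 (U `\` V)).
  exists V; split => //; first by left.
  by apply: IH => // altV1; apply: nalt2; exists V.
apply: (sign_blocks_null upU upV VU mUV).
  by apply/eqP; rewrite eq_le m2UV measure_ge0.
by apply: sign_blocks_sym; apply: one_sided_blocks => //; exact: singular_sym.
Qed.

End sign_blocks.

(** * Regularity of finite Borel measures *)
Section regularity.
Context (T : ptopologicalType) (R : realType).
Variable m : {finite_measure set (borel T) -> \bar R}.
Local Open Scope ereal_scope.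

Definition regular (B : set (borel T)) := measurable B /\ forall e : R, (0 < e)%R ->
  exists C G : set T, [/\ closed C, open G, C `<=` B, B `<=` G & m (G `\` C) < e%:E].

Let small_difference (G : set T) (C : nat -> set T) (e : R) : open G ->
  (forall n, closed (C n)) -> (forall i j, (i <= j)%N -> C i `<=` C j) ->
  m (G `\` \bigcup_n C n) < e%:E -> exists n, m (G `\` C n) < e%:E.
Proof.
move=> oG cC Cnd me; apply: contrapT => /forallNP small.
have mF n : measurable (G `\` C n : set (borel T)).
  by apply: measurableD; [exact: open_borel|exact: closed_borel].
have bE : \bigcap_n (G `\` C n) = G `\` \bigcup_n C n.
  apply/seteqP; split => [x Gx|x [Gx nCx] n _].
    by split => [|[n _ Cx]]; [exact: (Gx 0%N Logic.I).1|exact: (Gx n Logic.I).2].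
  by split => // Cx; apply: nCx; exists n.
have F0 : m (G `\` C 0%N) < +oo by rewrite -ge0_fin_numE// fin_num_measure.
have mI : measurable (\bigcap_n (G `\` C n) : set (borel T)) by exact: bigcap_measurable.
have nd : {homo (fun n => G `\` C n : set (borel T)) : n k / (n <= k)%N >-> (k <= n)%O}.
  by move=> i j ij; apply/subsetPset => x [Gx nCx]; split => // /(Cnd _ _ ij).
have cv := nonincreasing_cvg_mu F0 mF mI nd.
move: me; rewrite -bE -(cvg_lim (@ereal_hausdorff R) cv) ltNge => /negP; apply.
apply: lime_ge; first exact: cvgP cv.
by apply: nearW => n /=; rewrite leNgt; apply/negP; exact: small.
Qed.

Hypothesis open_Fsigma : forall G : set T, open G -> exists C : nat -> set T,
  [/\ forall n, closed (C n), forall i j, (i <= j)%N -> C i `<=` C j & G = \bigcup_n C n].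

(** The regular sets form a sigma-algebra: complements exchange the two
    approximations, and a countable union of closed sets is replaced by a finite
    one at the cost of a small measure. *)
Lemma borel_regular B : measurable B -> regular B.
Proof.
apply: (@smallest_sub _ (sigma_algebra setT) open regular).
  split.
  - split => // e e0; exists set0, set0; split => //; first exact: closed0.
      exact: open0.
    by rewrite setD0 measure0 lte_fin.
  - move=> A [mA regA]; split; first by rewrite setTD; exact: measurableC.
    move=> e /regA[C [G [cC oG CA AG GC]]]; exists (~` G), (~` C).
    split; [exact: open_closedC|exact: closed_openC|by rewrite setTD; exact: subsetC|
      by rewrite setTD; exact: subsetC|].
    by rewrite setDE setCK setIC -setDE.
  - move=> A regA; have mA n := (regA n).1; split; first exact: bigcup_measurable.
    move=> e e0; have e2 : (0 < e / 2)%R by rewrite divr_gt0.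
    have en n : (0 < e / 2 / (2 ^ n.+1)%:R)%R by rewrite divr_gt0.
    have [C CP] := choice (fun n => (regA n).2 _ (en n)).
    have [G GP] := choice CP.
    have oG : open (\bigcup_n G n) by apply: bigcup_open => n _; have [] := GP n.
    pose K n := \bigcup_(i in `I_n) C i.
    have cK n : closed (K n).
      by apply: closed_bigcup => [|i _]; [exact: finite_II|have [] := GP i].
    have KE : \bigcup_n K n = \bigcup_n C n.
      apply/seteqP; split => [x [n _ [i _ Cx]]|x [n _ Cx]]; first by exists i.
      by exists n.+1 => //; exists n => /=.
    have mGC n : measurable (G n `\` C n : set (borel T)).
      by have [cC oG' _ _ _] := GP n; apply: measurableD; [exact: open_borel|exact: closed_borel].
    have [||n nsmall] := @small_difference (\bigcup_n G n) K e oG cK.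
    + by move=> i j ij x [k ki Cx]; exists k => //=; exact: leq_trans ij.
    + rewrite KE; apply: (@le_lt_trans _ _ (e / 2)%:E); last first.
        by rewrite lte_fin ltr_pdivrMr// ltr_pMr// ltr1n.
      apply: le_trans (epsilon_trick0 xpredT (ltW e2)).
      apply: (@le_trans _ _ (\sum_(n <oo) m (G n `\` C n))); last first.
        by apply: lee_nneseries => // n _; have [_ _ _ _ /ltW] := GP n.
      apply: measure_sigma_subadditive => //.
        apply: measurableD; first exact: open_borel.
        by apply: bigcup_measurable => n _; apply: closed_borel; have [] := GP n.
      by move=> x [[n _ Gx] nCx]; exists n => //; split => // Cx; apply: nCx; exists n.
    + exists (K n), (\bigcup_n G n); split => //.
      * by move=> x [i _ Cx]; exists i => //; have [_ _ + _ _] := GP i; apply.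
      * by move=> x [i _ Ax]; exists i => //; have [_ _ _ + _] := GP i; apply.
move=> U oU; split; first exact: open_borel.
move=> e e0; have [C [cC Cnd UC]] := open_Fsigma oU.
have [||n nsmall] := @small_difference U C e oU cC; first exact: Cnd.
  by rewrite -UC setDv measure0 lte_fin.
exists (C n), U; split => //.
by rewrite UC => x Cx; exists n.
Qed.

End regularity.

(** * Test functions on an interval *)
Section capped_distance.
Context (R : realType).
Implicit Types (A : set R) (r s : R).

(** The cap makes the infimum range over a nonempty set even when [A] is empty. *)
Definition capped_dist A r := inf (1 |` [set `|r - y| | y in A]).

Let lb A r : has_lbound (1 |` [set `|r - y| | y in A]).
Proof. by exists 0 => _ [->|[y _ <-]]. Qed.

Let ne A r : (1 |` [set `|r - y| | y in A]) !=set0.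
Proof. by exists 1; left. Qed.

Lemma capped_dist_ge0 A r : 0 <= capped_dist A r.
Proof. by apply: lb_le_inf => // _ [->|[y _ <-]]. Qed.

Lemma capped_dist_le1 A r : capped_dist A r <= 1.
Proof. by apply: ge_inf => //; left. Qed.

Lemma capped_dist_in A r : A r -> capped_dist A r = 0.
Proof.
move=> Ar; apply/eqP; rewrite eq_le capped_dist_ge0 andbT.
by apply: ge_inf => //; right; exists r => //; rewrite subrr normr0.
Qed.

Lemma capped_dist_gt0 A r : closed A -> ~ A r -> 0 < capped_dist A r.
Proof.
move=> /closed_openC; rewrite openE => /[apply] /nbhs_ballP[e /= e0 eA].
apply: (@lt_le_trans _ _ (Num.min e 1)); first by rewrite lt_min e0 /=.
apply: lb_le_inf => // _ [->|[y Ay <-]]; first by rewrite ge_min lexx orbT.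
rewrite ge_min; apply/orP; left; rewrite leNgt; apply/negP => ry.
exact: (eA y).
Qed.

Lemma capped_dist_lipschitz A r s : capped_dist A r - capped_dist A s <= `|r - s|.
Proof.
rewrite lerBlDl -lerBlDr; apply: lb_le_inf => // _ [->|[y Ay <-]].
  by rewrite lerBlDr (le_trans (capped_dist_le1 _ _))// lerDl.
rewrite lerBlDr addrC; apply: (@le_trans _ _ `|r - y|).
  by apply: ge_inf => //; right; exists y.
by rewrite -(subrKA s); exact: ler_normD.
Qed.

Lemma capped_dist_continuous A : continuous (capped_dist A).
Proof.
move=> r; apply/cvgrPdist_lt => e e0; exists e => //= s rs.
apply: le_lt_trans rs; rewrite ler_norml; apply/andP; split.
  by rewrite lerNl opprB distrC capped_dist_lipschitz.
exact: capped_dist_lipschitz.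
Qed.

End capped_distance.

Section interval_topology.
Context (R : realType) (I : set R) (I0 : I !=set0).
Local Notation J := (borel (subline I0)).
Local Notation pos := (@subline_val R I I0).

Lemma in_interval (x : subline I0) : I (pos x).
Proof. exact: set_valP. Qed.

Lemma subline_of r : I r -> exists x : subline I0, pos x = r.
Proof. by move=> Ir; exists (exist _ r (mem_set Ir)). Qed.

Lemma open_subline (G : set (subline I0)) : open G ->
  exists2 G' : set R, open G' & G = pos @^-1` G'.
Proof. by move=> [G' oG' <-]; exists G'. Qed.

(** The inclusion of the interval in the line is an embedding. *)
Lemma compact_subline (K : set (subline I0)) : compact (pos @` K) -> compact K.
Proof.
move=> cK F PF FK; have FKp : F (pos @^-1` (pos @` K)).
  by apply: filterS FK => x Kx; exists x.
have [_ [[x Kx <-] clx]] := cK (pos @ F) _ FKp.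
exists x; split => // A U FA [_ [[V oV <-] Vx] VU].
have FpA : F (pos @^-1` (pos @` A)) by apply: filterS FA => y Ay; exists y.
have nV : nbhs (pos x) V by apply: open_nbhs_nbhs.
have [_ [[y Ay <-] Vy]] := clx _ _ FpA nV.
by exists y; split => //; exact: VU.
Qed.

Hypothesis I_interval : is_interval I.

(** An interval is open in its closure, as it lacks at most its two end points. *)
Lemma closed_frontier : closed (closure I `\` I).
Proof.
rewrite -openC openE => r nr; have [Ir|nIr] := pselect (I r); last first.
  have : (~` closure I) r by move=> clr; apply: nr.
  have /closed_openC := @closed_closure _ I; rewrite openE => /[apply].
  by apply: filterS => s ncl [].
have side (Q : set R) : (forall y, I y -> ~ Q y) -> open Q -> forall z, closure I z -> ~ Q z.
  by move=> IQ oQ z clz Qz; have [y [/IQ]] := clz _ (open_nbhs_nbhs (conj oQ Qz)).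
have [V1 nV1 V1P] : exists2 V : set R, nbhs r V & forall z, V z -> closure I z -> r < z -> I z.
  have [[y Iy ry]|noy] := pselect (exists2 y, I y & r < y).
    exists [set z | z < y]; first exact: open_nbhs_nbhs.
    by move=> z /= zy _ rz; apply: (I_interval Ir Iy); rewrite !ltW.
  exists setT; first exact: filterT.
  move=> z _ clz rz; exfalso; apply: (side [set z | r < z]) clz rz.
    by move=> y Iy ry; apply: noy; exists y.
  exact: open_gt.
have [V2 nV2 V2P] : exists2 V : set R, nbhs r V & forall z, V z -> closure I z -> z < r -> I z.
  have [[y Iy ry]|noy] := pselect (exists2 y, I y & y < r).
    exists [set z | y < z]; first exact: open_nbhs_nbhs.
    by move=> z /= zy _ rz; apply: (I_interval Iy Ir); rewrite !ltW.
  exists setT; first exact: filterT.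
  move=> z _ clz rz; exfalso; apply: (side [set z | z < r]) clz rz.
    by move=> y Iy ry; apply: noy; exists y.
  exact: open_lt.
apply: filterS (filterI nV1 nV2) => z [V1z V2z] [clz nIz]; apply: nIz.
by case: (ltgtP r z) => [rz|zr|<-//]; [exact: V1P|exact: V2P].
Qed.

(** The denominator makes this function vanish at infinity without cutting off its
    support. *)
Definition cutoff (Z : set R) (r : R) := capped_dist Z r / (1 + `|r|).

Lemma cutoff_continuous Z : continuous (cutoff Z).
Proof.
move=> r; apply: cvgM; first exact: capped_dist_continuous.
apply: cvgV; first by rewrite gt_eqF// ltr_pwDl.
by apply: cvgD; [exact: cvg_cst|exact: cvg_norm].
Qed.

Lemma cutoff_ge0 Z r : 0 <= cutoff Z r.
Proof. by rewrite divr_ge0 ?capped_dist_ge0// addr_ge0. Qed.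

(** These functions increase with [k] to the indicator of the complement of [Z],
    when [Z] is closed. *)
Definition bump_at (Z : set R) (k : nat) (x : subline I0) : R :=
  Num.min 1 (k%:R * cutoff Z (pos x)).

Lemma bump_at_continuous Z k : continuous (bump_at Z k).
Proof.
have ch : continuous (fun r : R => Num.min 1 (k%:R * cutoff Z r)).
  move=> r; apply: (@continuous_min _ _ (fun=> 1) (fun r => k%:R * cutoff Z r)).
    exact: cst_continuous.
  by apply: cvgMl_tmp; exact: cutoff_continuous.
move=> x; apply: (@continuous_comp _ _ _ pos (fun r => Num.min 1 (k%:R * cutoff Z r))).
  exact: subline_val_continuous.
exact: ch.
Qed.

Lemma bump_at_ge0 Z k x : 0 <= bump_at Z k x.
Proof. by rewrite le_min ler01 mulr_ge0// cutoff_ge0. Qed.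

(** Where the function is at least [e], points of the closure of the interval are
    bounded and away from [Z], hence in the interval: that set is closed in the
    line, and compact. *)
Lemma bump_at_C0 Z k : closed Z -> closure I `\` I `<=` Z -> C0 (bump_at Z k).
Proof.
move=> cZ ZI; split; first exact: bump_at_continuous.
move=> e e0; pose L := [set r : R | e <= k%:R * cutoff Z r].
exists (pos @^-1` L); last first.
  move=> x /= /negP; rewrite -ltNge ger0_norm ?bump_at_ge0// => xe.
  by rewrite gt_min xe orbT.
apply: compact_subline.
have cL : closed L.
  apply: (@closed_comp _ _ (fun r => k%:R * cutoff Z r) [set y | e <= y]); last exact: closed_ge.
  by move=> r _; apply: cvgMl_tmp; exact: cutoff_continuous.
have -> : pos @` (pos @^-1` L) = closure I `&` L.
  apply/seteqP; split => [_ [x Lx <-]|r [clr Lr]].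
    by split => //; apply: subset_closure; exact: in_interval.
  have [Ir|nIr] := pselect (I r).
    by have [x xr] := subline_of Ir; exists x; rewrite /= xr.
  have Zr : Z r by exact: ZI.
  by move: Lr; rewrite /L /= /cutoff capped_dist_in// mul0r mulr0 leNgt e0.
apply: (@subclosed_compact _ _ `[- (k%:R / e), k%:R / e]).
- by apply: closedI; first exact: closed_closure.
- exact: segment_compact.
- move=> r [_ /= Lr]; rewrite in_itv /= -ler_norml ler_pdivlMr// mulrC.
  have r0 : 0 < 1 + `|r| by rewrite ltr_pwDl.
  move: Lr; rewrite /L /= /cutoff mulrA ler_pdivlMr// => /le_trans; move=> H.
  apply: (@le_trans _ _ (e * (1 + `|r|))); first by rewrite ler_pM2l// lerDr.
  by apply: H; rewrite ler_piMr// capped_dist_le1.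
Qed.

Lemma open_subline_Fsigma (G : set (subline I0)) : open G ->
  exists C : nat -> set (subline I0), [/\ forall n, closed (C n),
    forall i j, (i <= j)%N -> C i `<=` C j & G = \bigcup_n C n].
Proof.
move=> /open_subline[G' oG' ->]; pose d x := capped_dist (~` G') (pos x).
have cd : continuous d.
  move=> x; apply: (@continuous_comp _ _ _ pos (capped_dist (~` G'))).
    exact: subline_val_continuous.
  exact: capped_dist_continuous.
exists (fun n => [set x | n.+1%:R^-1 <= d x]); split.
- move=> n; apply: (@closed_comp _ _ d [set y | n.+1%:R^-1 <= y]); last exact: closed_ge.
  by move=> x _; exact: cd.
- move=> i j ij x /=; apply: le_trans.
  by rewrite lef_pV2 ?posrE// ler_nat.
- apply/seteqP; split => [x Gx|x [n _ /= dx]].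
    have dx : 0 < d x by apply: capped_dist_gt0; [exact: open_closedC|apply].
    exists (Num.truncn (d x)^-1) => //=; apply: ltW.
    by rewrite invf_plt ?posrE// truncnS_gt.
  apply: contrapT => nGx; move: dx.
  by rewrite /d capped_dist_in// leNgt invr_gt0 ltr0Sn.
Qed.

Local Open Scope ereal_scope.

(** By singularity, [m1] lives on a part of [O] that is [m2]-null.  An open set [G]
    between that part and [O] with small [m2]-mass satisfies [m2 G < m1 G], and the
    functions [bump_at] that increase to the indicator of [G] carry over the
    inequality. *)
Lemma test_function (m1 m2 : {finite_measure set J -> \bar R}) (O : set (subline I0)) :
  singular m1 m2 -> open O -> 0 < m1 O ->
  exists f : subline I0 -> R, [/\ C0 f, forall x, (0 <= f x)%R,
    forall x, (0 < f x)%R -> O x &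
    \int[m2]_x (f x)%:E < \int[m1]_x (f x)%:E].
Proof.
move=> [S mS [S1 S2]] oO m1O.
have mO : measurable (O : set J) by exact: open_borel.
have mB : measurable (O `\` S : set J) by exact: measurableD.
have m1B : m1 (O `\` S) = m1 O.
  rewrite [RHS](measureDI m1 mO mS) [X in _ = _ + X](measure_eq0S _ mS _ S1) ?adde0//.
  exact: measurableI.
have m1Of : m1 O \is a fin_num by rewrite fin_num_measure.
have [_ /(_ (fine (m1 O)))] := borel_regular m2 open_subline_Fsigma mB.
rewrite fine_gt0 ?m1O ?ltey_eq ?m1Of// => /(_ isT)[C [G0 [cC oG0 CB BG GC]]].
rewrite fineK// in GC.
pose G := G0 `&` O; have oG : open G by exact: openI.
have mG : measurable (G : set J) by exact: open_borel.
have mC : measurable (C : set J) by exact: closed_borel.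
have m2G : m2 G < m1 G.
  apply: (@lt_le_trans _ _ (m1 O)); last first.
    by rewrite -m1B le_measure ?inE// => x [Ox nSx]; split => //; exact: BG.
  apply: le_lt_trans GC; rewrite leNgt; apply/negP => GC.
  have mGC : measurable (G0 `\` C : set J) by apply: measurableD => //; exact: open_borel.
  have mC0 : m2 C = 0.
    by apply: (measure_eq0S mC (measurableC mS) _ S2) => x /CB[].
  have : m2 G <= m2 (G0 `\` C) + m2 C.
    apply: le_trans (measureU2 m2 mGC mC).
    rewrite le_measure ?inE//; first exact: measurableU.
    by move=> x [Gx _]; have [Cx|nCx] := pselect (C x); [right|left].
  by rewrite mC0 adde0 leNgt GC.
have [G' oG' GE] := open_subline oG.
pose Z := ~` G' `|` (closure I `\` I).
have cZ : closed Z by apply: closedU; [exact: open_closedC|exact: closed_frontier].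
have ZG x : Z (pos x) <-> ~ G x.
  rewrite GE /Z; split => [[//|[_ nI]]|nG]; last by left.
  by have := in_interval x.
have cvg_bump (m : {finite_measure set J -> \bar R}) :
    \int[m]_x (bump_at Z k x)%:E @[k --> \oo] --> m G.
  have -> : m G = \int[m]_x (\1_G x)%:E by rewrite integral_indic ?setIT.
  have bump_at_lim x : limn (fun k => (bump_at Z k x)%:E) = (\1_G x)%:E.
    apply/cvg_lim => //; apply: cvg_EFin; first by apply: nearW.
    rewrite indicE; have [/set_mem Gx|nGx] := boolP (x \in G); last first.
      have Zx : Z (pos x) by apply/ZG => Gx; move: nGx; rewrite mem_set.
      apply: cvg_near_cst; apply: nearW => k /=.
      by rewrite /bump_at /cutoff capped_dist_in// mul0r mulr0 min_r.
    have gx : (0 < cutoff Z (pos x))%R.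
      by rewrite divr_gt0 ?ltr_pwDl// capped_dist_gt0// => /ZG.
    apply: cvg_near_cst; exists (Num.truncn (cutoff Z (pos x))^-1).+1 => // k /= kx.
    rewrite /bump_at min_l// -ler_pdivrMr// mul1r ltW// (lt_le_trans (truncnS_gt _))//.
    by rewrite ler_nat.
  under eq_integral do rewrite -bump_at_lim.
  apply: cvg_monotone_convergence => //.
  - move=> k; apply/measurable_EFinP; apply: continuous_measurable_real.
    exact: bump_at_continuous.
  - by move=> k x _; rewrite lee_fin bump_at_ge0.
  - move=> x _ i j ij; rewrite lee_fin /bump_at le_min2//.
    by rewrite ler_wpM2r ?cutoff_ge0// ler_nat.
have [k kP] : exists k, \int[m2]_x (bump_at Z k x)%:E < \int[m1]_x (bump_at Z k x)%:E.
  apply: contrapT => /forallNP nk; move: m2G; rewrite ltNge => /negP; apply.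
  rewrite -(cvg_lim (@ereal_hausdorff R) (cvg_bump m1)).
  rewrite -(cvg_lim (@ereal_hausdorff R) (cvg_bump m2)).
  apply: lee_lim; [exact: cvgP (cvg_bump m1)|exact: cvgP (cvg_bump m2)|].
  by apply: nearW => k; rewrite leNgt; apply/negP; exact: nk.
exists (bump_at Z k); split => //.
- by apply: bump_at_C0 => // r; right.
- by move=> x; exact: bump_at_ge0.
- move=> x fx; apply: contrapT => nOx; move: fx.
  have Zx : Z (pos x) by apply/ZG => -[].
  by rewrite /bump_at /cutoff capped_dist_in// mul0r mulr0 min_r// ltxx.
Qed.

End interval_topology.

(** * Integrals against the image of a charge *)
Section kernel_mixture.
Context d1 d2 (T1 : measurableType d1) (T2 : measurableType d2) (R : realType).
Variables (m : {measure set T1 -> \bar R}) (k : T1 -> {measure set T2 -> \bar R}).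
Hypothesis mk : forall B, measurable B -> measurable_fun [set: T1] (k ^~ B).
Local Open Scope ereal_scope.

Definition mixture (B : set T2) : \bar R := \int[m]_x k x B.

Let mixture0 : mixture set0 = 0.
Proof. by apply: integral0_eq => x _; exact: measure0. Qed.

Let mixture_ge0 B : 0 <= mixture B.
Proof. by apply: integral_ge0 => x _; exact: measure_ge0. Qed.

Let mixture_sigma_additive : semi_sigma_additive mixture.
Proof.
move=> F mF tF mUF.
have -> : mixture (\bigcup_n F n) = \sum_(n <oo) mixture (F n).
  rewrite /mixture -integral_nneseries//; last by move=> n; exact: mk.
  by apply: eq_integral => x _; rewrite measure_semi_bigcup.
by apply: is_cvg_nneseries => n _ _; exact: mixture_ge0.
Qed.

HB.instance Definition _ := isMeasure.Build _ _ _ mixture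
  mixture0 mixture_ge0 mixture_sigma_additive.

End kernel_mixture.

Section bounded_functions.
Context d (X : measurableType d) (R : realType).

Definition bounded_measurable (g : X -> R) :=
  measurable_fun [set: X] g /\ exists M, forall x, `|g x| <= M.

Lemma bounded_measurable_integrable (m : {measure set X -> \bar R}) g A :
  (m [set: X] < +oo)%E -> bounded_measurable g -> measurable A ->
  m.-integrable A (EFin \o g).
Proof.
move=> mfin [mg [M gM]] mA; apply: measurable_bounded_integrable => //.
- by apply: le_lt_trans mfin; rewrite le_measure ?inE.
- exact: measurable_funTS.
- exists M; split; first exact: num_real.
  by move=> x Mx y _; exact: le_trans (gM y) (ltW Mx).
Qed.

Lemma finite_measure_lty (m : {finite_measure set X -> \bar R}) : (m [set: X] < +oo)%E.
Proof. by rewrite -ge0_fin_numE// fin_num_measure. Qed.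

End bounded_functions.

Section signed_integrals.
Context d (X : measurableType d) (R : realType).
Implicit Types (nu : {charge set X -> \bar R}) (g : X -> R).

Definition signed_integral nu g :=
  \int[charge_pos nu]_x g x - \int[charge_neg nu]_x g x.

Lemma charge_posB_neg nu B : measurable B ->
  (charge_pos nu B - charge_neg nu B = nu B)%E.
Proof.
move=> mB; rewrite (jordan_decomp (svalP (cid (svalP (cid (Hahn_decomposition nu))))) mB).
by rewrite /cadd /= cscaleN1.
Qed.

End signed_integrals.

Section kernel_integral.
Context (R : realType) (I : set R) (I0 : I !=set0).
Local Notation J := (borel (subline I0)).
Local Notation E := (spacetime I0).
Context (T : R -> (E -> R) -> E -> R) (P : R -> R.-spker E ~> E).
Hypotheses (T_semigroup : C0_contraction_semigroup T) (P_T : represents T P).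
Hypothesis P_space_time : is_space_time P.
Variables (r : R) (hr : half_line R) (H : E -> R).
Hypotheses (r0 : 0 <= r) (hrE : subline_val hr = r) (cH : C0 H).

Lemma C0_slice_continuous (p : half_line R) (G : E -> R) : C0 G ->
  continuous (fun y : subline I0 => G (p, y)).
Proof.
move=> [cG _] y; apply: (@continuous_comp _ _ _ (fun y : subline I0 => (p, y)) G); last exact: cG.
move=> U [[A B] /= [nA nB] AB].
by apply: filterS nB => z Bz; apply: AB; split => //=; exact: nbhs_singleton.
Qed.

Lemma C0_slice_bounded (p : half_line R) (G : E -> R) : C0 G ->
  bounded_measurable (fun y : J => G (p, y)).
Proof.
move=> cG; split; last by have [M _ GM] := C0_bounded cG; exists M => y.
by apply: continuous_measurable_real; exact: C0_slice_continuous.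
Qed.

Let measurable_space : measurable_fun [set: E] (fun e : E => e.2 : J).
Proof. by apply: continuous_borel_measurable => -[p x]; exact: cvg_snd. Qed.

Lemma spatial_kernel_lty (x : J) : (mspatial_kernel P r x [set: J] < +oo)%E.
Proof. by apply: (le_lt_trans (sprob_kernel_le1 _ _)); rewrite ltry. Qed.

(** [P_r] started at time [0] only charges the states with time coordinate [r],
    where [H] and its slice agree. *)
Lemma spatial_integral (x : J) :
  (\int[mspatial_kernel P r x]_y (H (hr, y))%:E = (T r H (half_line0 R, x))%:E)%E.
Proof.
have bH := C0_slice_bounded hr cH.
have mdirac B : measurable B -> measurable_fun [set: E] (fun e : E => \d_(e.2 : J) B : \bar R).
  move=> mB; apply/measurable_EFinP.
  exact: (measurableT_comp (measurable_indic mB) measurable_space).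
have diracE' B : measurable B -> (mspatial_kernel P r x B =
    \int[P r (half_line0 R, x)]_(e in [set: E]) \d_(e.2 : J) B)%E.
  move=> mB; have mB' : measurable ((fun e : E => e.2 : J) @^-1` B).
    by rewrite -[X in measurable X]setTI; exact: measurable_space.
  have := @integral_indic _ _ _ (P r (half_line0 R, x)) _ measurableT _ mB'.
  by rewrite setIT => /esym.
rewrite (integral_mixture measurableT mdirac diracE'); last first.
  exact: (bounded_measurable_integrable (spatial_kernel_lty x) bH).
have mH : measurable_fun [set: E] (fun e => (H e)%:E).
  by apply/measurable_EFinP; exact: (continuous_measurable_real cH.1).
rewrite P_T//; under eq_integral.
  move=> e _; rewrite integral_dirac//; last by apply/measurable_EFinP; exact: bH.1.
  rewrite diracT mul1e; over.
apply: ae_eq_integral => //.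
  apply/measurable_EFinP; exact: (measurableT_comp bH.1 measurable_space).
pose B := [set e : E | subline_val e.1 <> subline_val (half_line0 R) + r].
exists B; split.
- exact: measurable_time_neq.
- exact: (P_space_time ((half_line0 R, x) : E) r0).
- move=> [p y] /= pB; move=> pE; apply: pB => _; congr (H (_, _))%:E.
  by apply: subline_val_inj; rewrite hrE pE add0r.
Qed.

(** The Jordan parts of the image of [mu] differ from the images of the Jordan
    parts of [mu], but the two pairs of measures have the same difference.
    Cross-addition turns this into an equality of positive measures. *)
Lemma signed_integral_kernel (mu : {charge set J -> \bar R}) :
  signed_integral (charge_kernel mu (mspatial_kernel P r)) (fun y => H (hr, y)) =
  signed_integral mu (fun x => T r H (half_line0 R, x)).
Proof.
have bH := C0_slice_bounded hr cH.
pose Q := mspatial_kernel P r.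
have mQ B : measurable B -> measurable_fun [set: J] (Q ^~ B).
  by move=> mB; exact: measurable_kernel.
have mixE (m : {finite_measure set J -> \bar R}) :
  exists2 m' : {measure set J -> \bar R}, (m' [set: J] < +oo)%E /\
    (forall B, measurable B -> m' B = \int[m]_x Q x B)%E &
    \int[m']_y H (hr, y) = \int[m]_x T r H (half_line0 R, x).
  have @m' : {measure set J -> \bar R} by refine (mixture m Q).
  have m'fin : (m' [set: J] < +oo)%E.
    apply: le_lt_trans (finite_measure_lty m).
    rewrite -[leRHS]mul1e -integral_cst//; apply: ge0_le_integral => //.
      exact: (mQ setT measurableT).
    by move=> x _; exact: sprob_kernel_le1.
  exists m' => //; congr fine; rewrite (@integral_mixture _ _ _ _ _ m setT measurableT Q)//.
    by apply: eq_integral => x _; exact: spatial_integral.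
  exact: bounded_measurable_integrable.
rewrite [RHS]/signed_integral.
have [mp [mpfin mpE] <-] := mixE (charge_pos mu).
have [mn [mnfin mnE] <-] := mixE (charge_neg mu).
set nu := charge_kernel mu Q.
have posfin := finite_measure_lty (charge_pos nu).
have negfin := finite_measure_lty (charge_neg nu).
have int (m : {measure set J -> \bar R}) : (m [set: J] < +oo)%E ->
    m.-integrable [set: J] (EFin \o (fun y => H (hr, y))).
  by move=> mfin; exact: bounded_measurable_integrable.
have sums : (\int[measure_add (charge_pos nu) mn]_y (H (hr, y))%:E =
             \int[measure_add mp (charge_neg nu)]_y (H (hr, y))%:E)%E.
  apply: eq_measure_integral => B mB _.
  apply: (etrans (measure_addE _ _ _)); apply: etrans (esym (measure_addE _ _ _)).
  have := charge_posB_neg nu mB; rewrite /nu /= /charge_kernel /charge_integral -mpE// -mnE//.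
  have fin (m : {measure set J -> \bar R}) : (m [set: J] < +oo)%E -> m B \is a fin_num.
    move=> mfin; rewrite ge0_fin_numE//; apply: le_lt_trans mfin.
    by rewrite le_measure ?inE.
  have := fin _ posfin; have := fin _ negfin; have := fin _ mpfin; have := fin _ mnfin.
  rewrite /nu.
  move: (charge_pos _ B) (charge_neg _ B) (mp B) (mn B) => [p| |] [q| |] [p'| |] [q'| |]//=.
  by move=> _ _ _ _ [pq]; congr EFin; lra.
rewrite !integral_measure_add// in sums; try exact: int.
rewrite /signed_integral /Rintegral.
have := integrable_fin_num measurableT (int _ posfin).
have := integrable_fin_num measurableT (int _ negfin).
have := integrable_fin_num measurableT (int _ mpfin).
have := integrable_fin_num measurableT (int _ mnfin).
rewrite /= in sums *; move: sums.
move: (\int[charge_pos nu]_x _)%E (\int[charge_neg nu]_x _)%E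
  (\int[mp]_x _)%E (\int[mn]_x _)%E => [p| |] [q| |] [p'| |] [q'| |]//=.
by move=> [pq] _ _ _ _; lra.
Qed.

End kernel_integral.

(** * Block integrals *)
Section block_rows.
Context (R : realType) (I : set R) (I0 : I !=set0).
Local Notation J := (borel (subline I0)).
Local Notation pos := (@subline_val R I I0).
Variables (m1 m2 : {finite_measure set J -> \bar R}) (n : nat) (g : 'I_n -> J -> R).
Hypothesis bg : forall j, bounded_measurable (g j).

Let int (m : {finite_measure set J -> \bar R}) j A : measurable A ->
  m.-integrable A (EFin \o g j).
Proof. by move=> mA; exact: bounded_measurable_integrable (finite_measure_lty m) (bg j) mA. Qed.

Let comb (m : {finite_measure set J -> \bar R}) A (c : 'I_n -> R) (s : seq 'I_n) :
  measurable A ->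
  \int[m]_(x in A) (\sum_(j <- s) c j * g j x) =
    \sum_(j <- s) \int[m]_(x in A) g j x * c j /\
  m.-integrable A (EFin \o (fun x => \sum_(j <- s) c j * g j x)).
Proof.
move=> mA; elim: s => [|j s [IH1 IH2]].
  split.
    by under eq_Rintegral do rewrite big_nil; rewrite big_nil Rintegral_cst// mul0r.
  by rewrite /comp; under eq_fun do rewrite big_nil; exact: integrable0.
have intj : m.-integrable A (EFin \o (fun x => c j * g j x)).
  rewrite /comp; under eq_fun do rewrite EFinM.
  by apply: integrableZl => //; exact: int.
split.
  under eq_Rintegral do rewrite big_cons.
  by rewrite RintegralD// IH1 RintegralZl// ?big_cons 1?mulrC//; exact: int.
by rewrite /comp; under eq_fun do rewrite big_cons EFinD; exact: integrableD.
Qed.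

Lemma Rintegral_comb_gt0 (m : {finite_measure set J -> \bar R}) A (c : 'I_n -> R) :
  measurable A -> 0 < \sum_j \int[m]_(x in A) g j x * c j ->
  exists2 x, A x & 0 < \sum_j c j * g j x.
Proof.
move=> mA; have [<- gi] := comb m c (index_enum _) mA => i0; apply: contrapT => nx.
have i00 : m.-integrable A (EFin \o (fun=> 0)) by exact: integrable0.
have := le_Rintegral mA gi i00; rewrite Rintegral_cst// mul0r leNgt i0 => H.
suff : false by []; apply: H => x Ax.
by rewrite leNgt; apply/negP => gx; apply: nx; exists x.
Qed.

Lemma Rintegral_null (m : {finite_measure set J -> \bar R}) j A :
  measurable A -> m A = 0%E -> \int[m]_(x in A) g j x = 0.
Proof.
move=> mA mA0; rewrite /Rintegral null_set_integral//.
by apply/measurable_EFinP; apply: measurable_funTS; exact: (bg j).1.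
Qed.

Lemma Rintegral_setD (m : {finite_measure set J -> \bar R}) j (U V : set J) :
  measurable U -> measurable V -> V `<=` U ->
  \int[m]_(x in U) g j x = \int[m]_(x in U `\` V) g j x + \int[m]_(x in V) g j x.
Proof.
move=> mU mV VU; have mUV : measurable (U `\` V) by exact: measurableD.
rewrite -{1}(setDUK VU) setUC Rintegral_setU//.
- by apply: int; exact: measurableU.
- by apply/disj_setPS => x [[]].
Qed.

(** The row [N i] holds the integrals over the block [B i] against the measure that
    may charge it, and [d i] is the sign of this measure in [m1 - m2].  A
    combination of the functions with a positive integral over a block is positive
    somewhere on it. *)
Lemma block_rows k (U : set J) : upset U -> sign_blocks m1 m2 k U ->
  exists (N : nat -> 'I_n -> R) (d : nat -> R) (B : nat -> set J),
  [/\ forall j, \int[m1]_(x in U) g j x - \int[m2]_(x in U) g j x = \sum_(i < k) d i * N i j,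
      forall i, (i < k)%N -> B i `<=` U,
      forall i i', (i < i' < k)%N -> forall x y, B i x -> B i' y -> pos x < pos y &
      forall i (c : 'I_n -> R), (i < k)%N -> 0 < \sum_j N i j * c j ->
        exists2 x, B i x & 0 < \sum_j c j * g j x].
Proof.
elim: k U => [|k IH] U upU.
  move=> [U1 U2]; exists (fun _ _ => 0), (fun=> 0), (fun=> set0); split => //.
  by move=> j; rewrite big_ord0 !Rintegral_null ?subrr//; exact: upset_measurable.
have mU := upset_measurable upU.
move=> [V [upV VU UV /(IH V upV)[N [d [B [eqN BV Bord Npos]]]]]].
have mV := upset_measurable upV; have mUV := upsetD_measurable upU upV.
have [m [s intE]] : exists (m : {finite_measure set J -> \bar R}) (s : R),
    forall j, \int[m1]_(x in U `\` V) g j x - \int[m2]_(x in U `\` V) g j x =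
      s * \int[m]_(x in U `\` V) g j x.
  case: UV => null; [exists m2, (-1)|exists m1, 1] => j; rewrite (Rintegral_null _ mUV null).
    by rewrite sub0r mulN1r.
  by rewrite subr0 mul1r.
exists (fun i => if i is i'.+1 then N i' else fun j => \int[m]_(x in U `\` V) g j x).
exists (fun i => if i is i'.+1 then d i' else s).
exists (fun i => if i is i'.+1 then B i' else U `\` V).
split.
- move=> j; rewrite big_ord_recl /= -intE -eqN !(Rintegral_setD _ j mU mV VU).
  by rewrite addrACA -opprD.
- by case=> [|i] ik; [exact: subDsetl|exact: subset_trans (BV i ik) VU].
- case=> [|i] [|i'] //= ik x y; last exact: Bord.
  by move=> [Ux nVx] /(BV i' ik) Vy; exact: upset_lt upV nVx Vy.
- by case=> [|i] c ik; [exact: Rintegral_comb_gt0|exact: Npos].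
Qed.

End block_rows.

(** * Alternating test functions *)
Section alternating_test_functions.
Context (R : realType) (I : set R) (I0 : I !=set0) (I_interval : is_interval I).
Local Notation J := (borel (subline I0)).
Local Notation pos := (@subline_val R I I0).

Lemma open_slice (q q' : R) : open (ray q `\` [set x | q' <= pos x] : set (subline I0)).
Proof.
have -> : ray q `\` [set x | q' <= pos x] = pos @^-1` [set r | q < r < q'].
  apply/seteqP; split => x; rewrite /ray /=.
    by move=> [-> /negP]; rewrite -ltNge.
  by move=> /andP[qx xq]; split => //; apply/negP; rewrite -ltNge.
apply: open_comp => [x _|]; first exact: subline_val_continuous.
have -> : [set r | q < r < q'] = [set r | q < r] `&` [set r | r < q'].
  by apply/seteqP; split => r /=; [move=> /andP[]|move=> [-> ->]].
by apply: openI; [exact: open_gt|exact: open_lt].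
Qed.

Lemma alternating_test_functions (m1 m2 : {finite_measure set J -> \bar R}) n q :
  singular m1 m2 -> separated_alternation m1 m2 n q ->
  exists f : nat -> subline I0 -> R,
  [/\ forall j, C0 (f j), forall j x, 0 <= f j x,
      forall j x, (j < n)%N -> 0 < f j x -> q < pos x,
      forall i j x y, (i < j < n)%N -> 0 < f i x -> 0 < f j y -> pos x < pos y &
      forall j, (j < n)%N -> 0 < (-1) ^+ j * (\int[m1]_x f j x - \int[m2]_x f j x)].
Proof.
elim: n m1 m2 q => [|n IH] m1 m2 q sm.
  exists (fun _ _ => 0); split => //; first by move=> j; exact: C0_cst0.
  by move=> i j x y; rewrite ltn0 andbF.
move=> [q' [qq' mO altq']].
have [f0 [C0f0 f0ge0 f0O intf0]] := test_function I_interval sm (@open_slice q q') mO.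
have [f [C0f fge0 fq ford falt]] := IH m2 m1 q' (singular_sym sm) altq'.
exists (fun j => if j is j'.+1 then f j' else f0); split.
- by case.
- by case.
- case=> [|j] x jn; first by move=> /f0O[].
  by move=> /(fq _ _ jn); exact: lt_trans.
- case=> [|i] [|j] //= x y ij; last exact: ford.
  move=> /f0O[_ /= /negP]; rewrite -ltNge => xq' /(fq _ _ ij).
  exact: lt_trans.
- case=> [|j] jn; last by rewrite exprS mulN1r mulNr -mulrN opprB falt.
  rewrite expr0 mul1r subr_gt0 -lte_fin /Rintegral.
  have bf0 : bounded_measurable (f0 : J -> R).
    split; first by apply: continuous_measurable_real; case: C0f0.
    by have [M _ fM] := C0_bounded C0f0; exists M.
  by rewrite !fineK//; apply: integrable_fin_num => //;
    apply: bounded_measurable_integrable => //; exact: finite_measure_lty.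
Qed.

End alternating_test_functions.

Section spacetime_lift.
Context (R : realType) (I : set R) (I0 : I !=set0).
Variables (p0 : half_line R) (f : subline I0 -> R).

Definition spacetime_lift (e : time_space I0) : R :=
  Num.max 0 (1 - `|subline_val e.1 - subline_val p0|) * f e.2.

Lemma spacetime_liftE x : spacetime_lift (p0, x) = f x.
Proof. by rewrite /spacetime_lift /= subrr normr0 subr0 max_r// mul1r. Qed.

Lemma C0_spacetime_lift : C0 f -> C0 spacetime_lift.
Proof.
move=> [cf f0]; pose h (r : R) := Num.max 0 (1 - `|r - subline_val p0|).
have ch : continuous h.
  move=> r; apply: (@continuous_max _ _ (fun=> 0) (fun r => 1 - `|r - subline_val p0|)).
    exact: cst_continuous.
  apply: cvgB; first exact: cvg_cst.
  by apply: cvg_norm; apply: cvgB; [exact: cvg_id|exact: cvg_cst].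
have h01 r : 0 <= h r <= 1.
  by rewrite /h le_max lexx ge_max ler01 gerBl normr_ge0.
have chE : continuous (fun e : time_space I0 => h (subline_val e.1)).
  move=> e; apply: (@continuous_comp _ _ _ (fun e : time_space I0 => subline_val e.1) h).
    exact: time_continuous.
  exact: ch.
have cfE : continuous (fun e : time_space I0 => f e.2).
  move=> e; apply: (@continuous_comp _ _ _ snd f); first exact: cvg_snd.
  exact: cf.
split; first by move=> e; apply: cvgM; [exact: chE|exact: cfE].
move=> e e0; have [K cK Kf] := f0 _ e0.
pose L := [set p : half_line R | `|subline_val p - subline_val p0| <= 1].
have cL : compact L.
  apply: compact_subline.
  have -> : (@subline_val _ _ _) @` L =
      `[subline_val p0 - 1, subline_val p0 + 1]%classic `&` [set r | 0 <= r].
    apply/seteqP; split => [_ [p Lp <-]|r [/=]].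
      split; last exact: (set_valP p).
      by move: Lp; rewrite /L /= in_itv /= ler_distl.
    rewrite in_itv /= -ler_distl => rp r0.
    by exists (exist _ r (mem_set (r0 : [set s : R | 0 <= s] r))).
  apply: (@subclosed_compact _ _ `[subline_val p0 - 1, subline_val p0 + 1]).
  - by apply: closedI; [exact: interval_closed|exact: closed_ge].
  - exact: segment_compact.
  - by move=> r [].
exists (L `*` K); first exact: compact_setX.
move=> [p x] /= /not_andP[nLp|nKx]; rewrite /spacetime_lift /= -/(h _).
  rewrite (_ : h _ = 0) ?mul0r ?normr0//.
  by rewrite /h max_l// subr_le0 ltW// ltNge; exact/negP.
have /andP[h0 h1] := h01 (subline_val p).
rewrite normrM (ger0_norm h0); apply: le_lt_trans (Kf x nKx).
by rewrite ler_piMl.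
Qed.

End spacetime_lift.

(** * Zero-crossings *)
Lemma charge_parts_singular (R : realType) (I : set R) (I0 : I !=set0)
  (nu : {charge set (borel (subline I0)) -> \bar R}) :
  singular (charge_pos nu) (charge_neg nu).
Proof.
pose P := sval (cid (Hahn_decomposition nu)).
pose N := sval (cid (svalP (cid (Hahn_decomposition nu)))).
have [[mP _] [mN _] _ PN0] : hahn_decomposition nu P N.
  exact: (svalP (cid (svalP (cid (Hahn_decomposition nu))))).
exists N => //; split.
  suff : (if N \in measurable then nu (N `&` P) else 0)%E = 0%E by [].
  by rewrite mem_set// setIC PN0 charge0.
suff : ((-1)%:E * (if (~` N) \in measurable then nu (~` N `&` N) else 0))%E = 0%E by [].
rewrite mem_set; last exact: measurableC.
by rewrite setICl charge0 mule0.
Qed.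

Section combination.
Context (R : realType) (X : ptopologicalType) (T : R -> (X -> R) -> X -> R).
Hypothesis T_semigroup : C0_contraction_semigroup T.
Variables (n : nat) (F : 'I_n -> X -> R) (c : 'I_n -> R).
Hypothesis C0F : forall j, C0 (F j).

Lemma semigroup_comb t : 0 <= t ->
  C0 (fun x => \sum_j c j * F j x) /\
  T t (fun x => \sum_j c j * F j x) = (fun x => \sum_j c j * T t (F j) x).
Proof.
move=> t0; elim: (index_enum _) => [|j s [IH1 IH2]].
  under eq_fun do rewrite big_nil;
  under [X in _ /\ _ = X]eq_fun do rewrite big_nil.
  have c0 := C0_cst0 R X; split => //.
  have := semigroup_sub T_semigroup t0 c0 c0; rewrite subrr => ->.
  by apply/funext => x; rewrite subrr.
under eq_fun do rewrite big_cons;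
under [X in _ /\ _ = X]eq_fun do rewrite big_cons.
by split; [exact: C0_axpy|rewrite (C0sg_linear T_semigroup)// IH2].
Qed.

End combination.

(** Consecutive values carry opposite signs, so they differ. *)
Lemma increasing_of_sign_changes (R : realFieldType) m n (h : 'I_m -> 'I_n) (c : 'I_n -> R) :
  (forall i j : 'I_m, (i < j)%N -> (h i <= h j)%N) ->
  (forall i : 'I_m, 0 < (-1) ^+ i * c (h i)) -> increasing h.
Proof.
move=> weak ch; have strict (i j : 'I_m) : i.+1 = j :> nat -> (h i < h j)%N.
  move=> ij; rewrite ltn_neqAle weak ?andbT -?ij//; apply/eqP => /val_inj hij.
  have := ch j; rewrite -ij exprS mulN1r mulNr oppr_gt0 -hij => ci.
  by have := lt_trans (ch i) ci; rewrite ltxx.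
move=> i j ij; have im : (i.+1 < m)%N by exact: leq_ltn_trans ij (ltn_ord j).
apply: leq_trans (strict i (Ordinal im) erefl) _.
move: ij; rewrite leq_eqVlt => /predU1P[ij|ij]; last exact: weak.
by rewrite (_ : Ordinal im = j)//; exact: val_inj.
Qed.

Theorem theorem1p2 (R : realType) (I : set R) (I0 : I !=set0)
  (I_interval : is_interval I)
  (T : R -> (spacetime I0 -> R) -> spacetime I0 -> R)
  (P : R -> R.-spker spacetime I0 ~> spacetime I0)
  (T_semigroup : C0_contraction_semigroup T)
  (P_T : represents T P)
  (P_space_time : is_space_time P)
  (d : measure_display) (Omega : measurableType d)
  (Pr : spacetime_pt I0 -> probability Omega R)
  (W : R -> Omega -> spacetime_pt I0)
  (W_process : associated_process P Pr W)
  (W_diffusion : is_diffusion Pr W)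
  (mu : {charge set borel (subline I0) -> \bar R})
  (s t : R) (s_ge0 : 0 <= s) (s_lt_t : s < t) :
  (zero_crossings (charge_kernel mu (mspatial_kernel P t)) <=
   zero_crossings (charge_kernel mu (mspatial_kernel P s)))%E.
Proof.
set lam := charge_kernel mu (mspatial_kernel P t).
set nu := charge_kernel mu (mspatial_kernel P s).
suff alt n : has_alternation lam n.+1 -> has_alternation nu n.+1.
  rewrite /zero_crossings leeB//; apply: ereal_sup_le => _ [->|[[|n] [//= _ an] <-]].
    by left.
  right; exists n.+1; last exact: erefl.
  exact: (conj (ltn0Sn n) (alt n an)).
have a0 : 0 < t - s by rewrite subr_gt0.
have t_ge0 : 0 <= t by rewrite (le_trans s_ge0)// ltW.
pose s0 : half_line R := exist _ s (mem_set (s_ge0 : [set r : R | 0 <= r] s)).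
pose t0 : half_line R := exist _ t (mem_set (t_ge0 : [set r : R | 0 <= r] t)).
have st : subline_val t0 = subline_val s0 + (t - s) by rewrite addrC subrK.
apply: contrapT; move=> /not_implyP[alt_lam nalt_nu].
have blocks : sign_blocks (charge_pos nu) (charge_neg nu) n setT.
  apply: two_sided_blocks; [exact: charge_parts_singular|exact: upset_setT| |].
  - by move=> /mass_of_alternation altn; apply: nalt_nu; left.
  - by move=> /mass_of_alternation altn; apply: nalt_nu; right.
have core (l1 l2 : {finite_measure set borel (subline I0) -> \bar R}) (sg : R) q :
    singular l1 l2 -> separated_alternation l1 l2 n.+1 q ->
    ~ forall f, \int[l1]_x f x - \int[l2]_x f x = sg * signed_integral lam f.
  move=> sl altl lE.
  have [f [C0f f_ge0 _ ford falt]] := alternating_test_functions I_interval sl altl.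
  pose F j := spacetime_lift t0 (f j).
  have C0F j : C0 (F j) by exact: C0_spacetime_lift.
  have C0TF j : C0 (T (t - s) (F j)) by apply: C0sg_C0 T_semigroup _ _ (ltW a0) (C0F j).
  pose g (j : 'I_n.+1) (y : borel (subline I0)) := T (t - s) (F j) (s0, y).
  have bg j : bounded_measurable (g j) by exact: C0_slice_bounded.
  have intE (j : 'I_n.+1) : signed_integral lam (f j) = signed_integral nu (g j).
    have -> : f j = (fun y => F j (t0, y)).
      by apply/funext => y; rewrite /F spacetime_liftE.
    rewrite (signed_integral_kernel P_T P_space_time t_ge0 (erefl : subline_val t0 = t) (C0F j)).
    have -> : T t (F j) = T s (T (t - s) (F j)).
      rewrite -(C0sg_add T_semigroup s_ge0 (ltW a0) (C0F j)).
      by congr (T _ _); rewrite addrC subrK.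
    apply/esym; exact: (signed_integral_kernel P_T P_space_time s_ge0
      (erefl : subline_val s0 = s) (C0TF j)).
  have [N [dd [B [eqN _ Bord Npos]]]] := block_rows bg (@upset_setT R I I0) blocks.
  pose NM : 'M[R]_(n, n.+1) := \matrix_(i < n, j < n.+1) N i j.
  pose v : 'rV[R]_n.+1 := \row_j (sg * signed_integral lam (f j)).
  apply: (@variation_diminishing_no_alternation R n NM v); last first.
  - by move=> j; rewrite mxE -lE; exact: falt.
  - apply/submxP; exists (\row_i (sg * dd i)); apply/rowP => j.
    rewrite !mxE intE /signed_integral eqN mulr_sumr.
    by apply: eq_bigr => i _; rewrite !mxE mulrA.
  move=> c m h hh alth.
  have pickx i : exists x : borel (subline I0),
      B (h i) x /\ 0 < \sum_j ((-1) ^+ nat_of_ord i * c j 0) * g j x.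
    have gi : 0 < \sum_j N (h i) j * ((-1) ^+ nat_of_ord i * c j 0).
      have := alth i; rewrite mxE mulr_sumr.
      by under eq_bigr do rewrite mxE mulrCA.
    have [y By gy] := Npos (h i) _ (ltn_ord (h i)) gi.
    exact: (ex_intro _ y (conj By gy)).
  have [x xP] := choice pickx.
  have [C0Fc TFc] := semigroup_comb T_semigroup (fun j => c j 0)
    (fun j : 'I_n.+1 => C0F j) (ltW a0).
  have [|i|z [zz zF]] := semigroup_variation_diminishing T_semigroup P_T P_space_time
    W_process W_diffusion a0 (y := x) C0Fc st.
  - move=> i j ij; apply: (Bord (h i) (h j)); [by rewrite hh//=|exact: (xP i).1|exact: (xP j).1].
  - rewrite TFc mulr_sumr; have := (xP i).2.
    by under eq_bigr do rewrite -mulrA.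
  have pick i : exists j : 'I_n.+1, 0 < f j (z i) /\ 0 < (-1) ^+ i * c j 0.
    apply: contrapT => /forallNP nj; have := zF i; rewrite ltNge => /negP; apply.
    rewrite mulr_sumr; apply: sumr_le0 => j _; rewrite /F spacetime_liftE mulrA.
    have [fj|fj] := ltP 0 (f j (z i)); last first.
      have -> : f j (z i) = 0 by apply/eqP; rewrite eq_le fj f_ge0.
      by rewrite mulr0.
    rewrite leNgt (pmulr_lgt0 _ fj); apply/negP => cj; exact: (nj j (conj fj cj)).
  have [h' h'P] := choice pick; exists h'; last by move=> i; exact: (h'P i).2.
  have weak (i j : 'I_m) : (i < j)%N -> (h' i <= h' j)%N.
    move=> ij; rewrite leqNgt; apply/negP => ji; have := zz i j ij.
    rewrite ltNge => /negP; apply; apply/ltW/(ford (h' j) (h' i)).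
    + by rewrite ji ltn_ord.
    + exact: (h'P j).1.
    + exact: (h'P i).1.
  exact: (increasing_of_sign_changes (c := c^~ 0) weak (fun i => (h'P i).2)).
have slam := charge_parts_singular lam.
case: alt_lam => /alternation_of_mass[q altq].
- by apply: (core _ _ 1 _ slam altq) => f; rewrite mul1r.
- by apply: (core _ _ (-1) _ (singular_sym slam) altq) => f; rewrite mulN1r opprB.
Qed.
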